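(* Assume that $\mathcal{T}_{MC}$ is purely atomic. Assume that for every $A,B\in\mathcal{T}_{MC}$, $\nu(A\rightarrow B)$ is either $0$ or infinite. Then, under $\mathbb{P}$, every event in $\mathcal{T}_{RI}$ has probability either $0$ or $1$.
   Context: Weighted graph and Markov chain. $\mathcal{G}=(\mathbb{V},\mathcal{E})$ is a simple undirected connected locally finite graph with countable vertex set; $\mathbf{a}=(a_{x,y})_{(x,y)\in\mathcal{E}}$ is a family of positive conductances with $a_{x,y}=a_{y,x}$; $a_x:=\sum_{z\sim x}a_{x,z}$. $X=(X_n)_{n\ge 0}$ is the Markov chain on $\mathbb{V}$ with transition probabilities $p_{x,y}=a_{x,y}/a_x$ if $(x,y)\in\mathcal{E}$ and $0$ otherwise; it is assumed to be transient. $P_x$ is the law of $X$ started from $x$. For $K\subset\mathbb{V}$, $\tau_K^+=\inf\{n\ge 1: X_n\in K\}$ ($\inf\emptyset=\infty$). For finite $K$, the equilibrium measure is $e_K(x)=a_xP_x[\tau_K^+=\infty]$ for $x\in K$ and $e_K(x)=0$ otherwise. Trajectories. $W^+$ (resp. $W$) is the set of nearest-neighbour trajectories in $\mathcal{G}$ indexed by $\{0,1,2,\dots\}$ (resp. by $\mathbb{Z}$) that visit each vertex only finitely many times, with the $\sigma$-algebra $\mathcal{W}^+$ (resp. $\mathcal{W}$) generated by the coordinate maps. The $P_x$ are probability measures on $(W^+,\mathcal{W}^+)$. $W_K\subset W$ is the set of trajectories that hit $K$. $W^*$ is the quotient of $W$ by time-translation ($w\sim w'$ iff $w_{n+k}=w'_n$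 for all $n$, for some $k\in\mathbb{Z}$), $\pi^*:W\to W^*$ is the projection, $\mathcal{W}^*$ is the $\sigma$-algebra inherited from $\mathcal{W}$ (quotient $\sigma$-algebra), and $W_K^*=\pi^*(W_K)$. Interlacement process. For finite $K$, $\nu_K$ is the measure on $(W,\mathcal{W})$ characterized by $\nu_K(\{w:(w_{-n})_{n\ge 0}\in A,\ w_0=x,\ (w_n)_{n\ge 0}\in B\})=P_x[A\mid\tau_K^+=\infty]\,e_K(x)\,P_x[B]$ for $x\in\mathbb{V}$, $A,B\in\mathcal{W}^+$ (read as $0$ if $e_K(x)=0$). $\nu$ is the unique measure on $(W^*,\mathcal{W}^* )$ such that for every finite $K\subset\mathbb{V}$ the restriction of $\nu$ to $W_K^*$ equals $\nu_K\circ(\pi^* )^{-1}$. $\Omega$ is the set of point measures $\omega=\sum_{i\ge 1}\delta_{w_i^*}$ on $W^*$ with $\omega(W_K^* )<\infty$ for all finite $K$, $\mathcal{A}$ is the $\sigma$-algebra on $\Omega$ generated by the maps $\omega\mapsto\omega(D)$, $D\in\mathcal{W}^*$, and $\mathbb{P}$ is the law on $(\Omega,\mathcal{A})$ of a Poisson point process with intensity measure $\nu$. Non-local events. For finite $K$ and $w\in W_K$, let $\tau_K(w)=\inf\{n\in\mathbb{Z}:w_n\in K\}$, $\lambda_K(w)=\sup\{n\in\mathbb{Z}:w_n\in K\}$, $\mathrm{Out}_{\to K}(w)=(w_{\tau_K(w)+n})_{n\le 0}$, $\mathrm{Out}_{K\to}(w)=(w_{\lambda_K(w)+n})_{n\ge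 0}$, and $\mathrm{Out}_K(w)=(\mathrm{Out}_{\to K}(w),\mathrm{Out}_{K\to}(w))$. For $\omega=\sum_{i\ge1}\delta_{w_i^*}\in\Omega$ with arbitrary representatives $w_i$ of $w_i^*$, set $\mathrm{Out}_K(\omega)=\sum_{i: w_i^*\in W_K^*}\delta_{\mathrm{Out}_K(w_i)}+\sum_{i:w_i^*\notin W_K^*}\delta_{w_i^*}$, a random point measure (on the disjoint union of the space of pairs of semi-infinite trajectories and $W^*$; point measures carry the $\sigma$-algebra generated by evaluations on measurable sets). $\mathcal{T}_{RI}=\bigcap_{K\subset\mathbb{V}\text{ finite}}\sigma(\mathrm{Out}_K)$. Invariant events. Let $\theta:W^+\to W^+$, $(w_n)_{n\ge0}\mapsto(w_{n+1})_{n\ge0}$, and $\mathcal{T}_{MC}=\{A\in\mathcal{W}^+:\theta^{-1}(A)=A\}$. For $A,B\in\mathcal{T}_{MC}$, ''$A\rightarrow B$'' denotes the image under $\pi^*$ of the set of $w\in W$ with $(w_{-n})_{n\ge0}\in A$ and $(w_n)_{n\ge0}\in B$. Pure atomicity. In a probability space $(\mathcal{X},\mathcal{J},\mathbb{Q})$, an event $A\in\mathcal{J}$ is atomic if $\mathbb{Q}(A)>0$ and every event included in $A$ has probability $\mathbb{Q}(A)$ or $0$; the space is purely atomic if there is an at most countable collection of atomic events partitioning $\mathcal{X}$. $\mathcal{T}_{MC}$ is purely atomic if $(W^+,\mathcal{T}_{MC},P_x)$ is purely atomic for some (equivalently, all) $x\in\mathbb{V}$. *)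

(* Defs.v *)
From HB Require Import structures.
From mathcomp Require Import all_boot all_order all_algebra.
From mathcomp Require Import generic_quotient.
From mathcomp Require Import all_classical all_reals all_analysis.
From mathcomp Require Import measurable_realfun.

Set Implicit Arguments.
Unset Strict Implicit.
Unset Printing Implicit Defensive.

Import Order.TTheory GRing.Theory Num.Theory.
Local Open Scope classical_set_scope.
Local Open Scope ring_scope.

(* Random interlacements on a transient weighted graph.

     halfTraj G, traj G   W^+, W
     trajClass G          W^*, with projection [to_class]
     configuration G      Omega
     invariant_events G   T_MC
     nonlocal_events G    T_RI

   The chain, the measures nu_K and nu and the law of the Poisson process are
   not constructed: [markov_law], [hitting_intensity],
   [interlacement_intensity] and [poisson_process] state the properties that
   determine them. *)

(* Generators of the sigma-algebra of the coordinate maps, V being discrete. *)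
Definition coordinate_sets (T I V : Type) (X : T -> I -> V) : set (set T) :=
  [set A | exists (i : I) (B : set V), A = [set w | B (X w i)]].

(* [pointedType] only makes the vertex set nonempty. The values of
   [conductance] off the edges are irrelevant. *)
Record network (R : realType) := Network {
  vertex :> pointedType;
  vertex_countable : countable [set: vertex];
  adj : rel vertex;
  adj_sym : symmetric adj;
  adj_irr : irreflexive adj;
  adj_conn : forall x y : vertex, exists2 p, path adj x p & last x p = y;
  adj_lf : forall x : vertex, finite_set [set y | adj x y];
  conductance : vertex -> vertex -> R;
  conductance_gt0 : forall x y, adj x y -> 0 < conductance x y;
  conductance_sym : forall x y, adj x y -> conductance x y = conductance y x
}.

Section markov_chain.
Context (R : realType) (G : network R).

Definition total_conductance (x : G) : R :=
  \sum_(z \in [set z | adj x z]) conductance x z.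

Definition transition (x y : G) : R :=
  if adj x y then conductance x y / total_conductance x else 0.

(* Under mu, (X w n)_n is the chain started at x: these finite-dimensional
   distributions determine mu on the sigma-algebra generated by X. *)
Definition markov_law (T : Type) (X : T -> nat -> G) (x : G)
    (mu : set T -> \bar R) :=
  forall (n : nat) (y : nat -> G),
    mu [set w | forall i, (i <= n)%N -> X w i = y i] =
    ((x == y 0)%:R * \prod_(i < n) transition (y i) (y i.+1))%:E.

Definition pathSpace :=
  g_sigma_algebraType (coordinate_sets (fun w : nat -> G => w)).

(* The chain never returns to its starting point with positive probability.
   Q is the law of the chain on all V-valued sequences, so that transience is
   stated before W^+ is available. *)
Definition transient := forall x : G,
  exists2 Q : probability pathSpace R, markov_law (fun w : pathSpace => w) x Q &
    (0 < Q [set w : pathSpace | forall n, (0 < n)%N -> w n <> x])%E.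

End markov_chain.

(* A [measurableType] is nonempty, so W^+ must be shown to be inhabited.
   Decomposing at the last visit to v gives
   \sum_n Q_x(w_n = v) * Q_v(no return to v) <= 1,
   and Borel-Cantelli yields a path that visits each vertex finitely often. *)
Section transient_trajectory.
Context (R : realType) (G : network R).
Local Notation S := (pathSpace G).

Let cyl n (y : nat -> G) : set S := [set w | forall i, (i <= n)%N -> w i = y i].

Let measurable_coord i (B : set G) : measurable ([set w | B (w i)] : set S).
Proof. by apply: sub_sigma_algebra; exists i, B. Qed.

Let measurable_cyl n y : measurable (cyl n y).
Proof.
rewrite (_ : cyl n y = \bigcap_i [set w : S | (i <= n)%N -> w i = y i]).
  apply: bigcapT_measurable => i.
  exact: (measurable_coord i (fun v => (i <= n)%N -> v = y i)).
by apply/seteqP; split=> [w wy i _|w wy i]; exact: wy.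
Qed.

Let code : {g : G -> nat | injective g}.
Proof.
apply: cid; have /countable_injP[g gi] := vertex_countable G.
by exists g => x y gxy; apply: gi => //; rewrite inE.
Qed.
Let g := sval code.

Let block n (k : nat) : set S :=
  [set w | pickle [seq g (w i) | i <- iota 0 n.+1] = k].

Let blockP n k (w w' : S) : block n k w -> block n k w' -> cyl n w' w.
Proof.
rewrite /block /mkset => <- /esym/(pcan_inj pickleK) ww i lein.
have /(congr1 (nth 0%N ^~ i)) := ww.
by rewrite !(nth_map 0%N) ?size_iota// nth_iota// => /(svalP code).
Qed.

Let cyl_block n k w : block n k w -> block n k = cyl n w.
Proof.
move=> wk; apply/seteqP; split=> [w' w'k|w' w'w]; first exact: blockP w'k wk.
rewrite /block /mkset in wk *; rewrite -wk; congr pickle; apply/eq_in_map => i.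
by rewrite mem_iota ltnS => /w'w ->.
Qed.

Let measurable_block n k : measurable (block n k).
Proof.
have [->|/set0P[w wk]] := eqVneq (block n k) set0; first exact: measurable0.
by rewrite (cyl_block wk); exact: measurable_cyl.
Qed.

Let block_trivIset n (X : set S) : trivIset setT (fun k => block n k `&` X).
Proof. by move=> i j _ _ [w [[/= wi _] [wj _]]]; rewrite -wi -wj. Qed.

Let bigcup_block n (X : set S) : \bigcup_k (block n k `&` X) = X.
Proof.
by rewrite -setI_bigcupl; apply/setIidPr => w _; eexists.
Qed.

Let measure_block n (mu : {measure set S -> \bar R}) X : measurable X ->
  mu X = (\sum_(k <oo) mu (block n k `&` X))%E.
Proof.
move=> mX; rewrite -[in LHS](bigcup_block n X) measure_semi_bigcup//.
- by move=> k; exact: measurableI.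
- by rewrite bigcup_block.
Qed.

Let cyls : set (set S) := [set A | A = set0 \/ exists n y, A = cyl n y].

Let cyls_gen : measurable = <<s cyls >> :> set (set S).
Proof.
apply/seteqP; split.
  apply: smallest_sub; first exact: smallest_sigma_algebra.
  move=> _ [i [B ->]].
  rewrite -(bigcup_block i [set w | B (w i)]).
  have [_ _ +] := smallest_sigma_algebra setT cyls; apply => k.
  have [E|/set0P[w [wk Bw]]] := eqVneq (block i k `&` [set w | B (w i)]) set0.
    by apply: sub_sigma_algebra; left.
  apply: sub_sigma_algebra; right; exists i, w.
  by rewrite -(cyl_block wk); apply/setIidPl => w' w'k;
    rewrite /mkset -(blockP wk w'k (leqnn i)).
apply: smallest_sub; first exact: sigma_algebra_measurable.
by move=> A [->|[n [y ->]]]; [exact: measurable0|exact: measurable_cyl].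
Qed.

Let cylsI : setI_closed cyls.
Proof.
move=> A B [->|[n [y ->]]]; first by left; rewrite set0I.
move=> [->|[m [z ->]]]; first by left; rewrite setI0.
have [E|/set0P[w [wy wz]]] := eqVneq (cyl n y `&` cyl m z) set0; first by left.
right; exists (maxn n m), w; apply/seteqP; split=> [w' [w'y w'z] i|w' w'w].
  by rewrite leq_max => /orP[lei|lei]; [rewrite w'y ?wy|rewrite w'z ?wz].
by split=> i lei; rewrite w'w ?(leq_max, lei, orbT)//; [exact: wy|exact: wz].
Qed.

Let shift n (w : S) : S := fun m => w (n + m)%N.

Let measurable_shift n : measurable_fun setT (shift n).
Proof.
apply: (@measurability _ _ S S setT (shift n)
  (coordinate_sets (fun w : nat -> G => w)) erefl).
move=> _ [_ [i [B ->]] <-]; rewrite setTI.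
exact: (measurable_coord (n + i) B).
Qed.

Variables (Q : G -> probability S R).
Hypothesis Qlaw : forall x, markov_law (fun w : S => w) x (Q x).

Let Q_cyl x n y :
  Q x (cyl n y) = ((x == y 0)%:R * \prod_(i < n) transition (y i) (y i.+1))%:E.
Proof. exact: Qlaw. Qed.

Let markov_cyl x n y D : measurable D ->
  Q x (shift n @^-1` D `&` cyl n y) = (Q x (cyl n y) * Q (y n) D)%E.
Proof.
pose c : {nonneg R} := NngNum (fine_ge0 (measure_ge0 (Q x) (cyl n y))).
have cE : (c%:num)%:E = Q x (cyl n y) by rewrite /= Q_cyl.
rewrite -cE => mD.
pose m2 : {measure set S -> \bar R} := mscale c (Q (y n)).
have m2E A : m2 A = (Q x (cyl n y) * Q (y n) A)%E by rewrite -cE.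
pose m1 := pushforward (mrestr (Q x) (measurable_cyl n y)) (shift n).
have [m m1m] : exists m : {measure set S -> \bar R}, m = m1 :> (_ -> _).
  by exists (measure_function_pushforward__canonical__measure_function_Measure
    (mrestr (Q x) (measurable_cyl n y)) (measurable_shift n)).
rewrite -[LHS]/(m1 D) -[RHS]/(m2 D) -m1m.
have cover k : cyls (block 0 k).
  have [->|/set0P[w wk]] := eqVneq (block 0 k) set0; first by left.
  by right; exists 0%N, w; exact: cyl_block.
move: mD; rewrite cyls_gen.
apply: (g_sigma_algebra_measure_unique cyls _ (block 0) cover _ m m2).
- by rewrite cyls_gen; exact: sub_sigma_algebra.
- by rewrite -[RHS](bigcup_block 0 setT); apply: eq_bigcupr => k _; rewrite setIT.
- exact: cylsI.
- move=> _ [->|[k [z ->]]]; first by rewrite !measure0.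
  rewrite m1m m2E /m1 /pushforward /mrestr !Q_cyl -EFinM.
  have [yz|yz] := eqVneq (y n) (z 0%N); last first.
    rewrite mul0r mulr0 (_ : _ `&` _ = set0) ?measure0//.
    apply/seteqP; split=> // w [/(_ 0%N)]; rewrite /shift addn0 => wz.
    by move/(_ n (leqnn n)) => wy; move: yz; rewrite -wy wz ?eqxx.
  pose u i := if (i <= n)%N then y i else z (i - n)%N.
  have uE j : u (n + j)%N = z j.
    rewrite /u; case: leqP => [|_]; last by rewrite addKn.
    by rewrite -{2}(addn0 n) leq_add2l leqn0 => /eqP ->; rewrite addn0.
  rewrite (_ : _ `&` _ = cyl (n + k) u).
    rewrite Q_cyl {1}/u leq0n -mulrA mul1r; congr (_ * _)%:E.
    rewrite big_split_ord/=; congr (_ * _); apply: eq_bigr => i _.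
      by rewrite /u ltn_ord ltnW.
    by rewrite -addnS !uE.
  apply/seteqP; split=> [w [wz wy] i lei|w wu].
    rewrite /u; case: leqP => [|ni]; first exact: wy.
    by rewrite -wz ?leq_subLR// /shift subnKC// ltnW.
  split=> i lei.
    by rewrite /shift wu ?leq_add2l.
  by rewrite wu ?(leq_trans lei) ?leq_addr// /u lei.
- move=> k; rewrite m1m /m1 /pushforward /mrestr.
  rewrite (le_lt_trans (probability_le1 _ _)) ?ltry//.
  apply: measurableI => //.
  by rewrite -[X in measurable X]setTI; exact: measurable_shift.
Qed.

Let at_ n (v : G) : set S := [set w | w n = v].

Let measurable_at n v : measurable (at_ n v).
Proof. exact: (measurable_coord n (fun u => u = v)). Qed.

Let markov x n v D : measurable D ->
  Q x (shift n @^-1` D `&` at_ n v) = (Q x (at_ n v) * Q v D)%E.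
Proof.
move=> mD; have mSD : measurable (shift n @^-1` D).
  by rewrite -[X in measurable X]setTI; exact: measurable_shift.
have QvD : Q v D = (fine (Q v D))%:E by rewrite fineK// fin_num_measure.
rewrite (measure_block n (Q x))//; last exact: measurableI.
rewrite [in RHS](measure_block n (Q x))// QvD muleC -nneseriesZl//.
apply: eq_eseriesr => k _; rewrite setICA muleC -QvD.
have [->|/set0P[w [wk wv]]] := eqVneq (block n k `&` at_ n v) set0.
  by rewrite setI0 measure0 mul0e.
have -> : block n k `&` at_ n v = cyl n w.
  rewrite -(cyl_block wk); apply/setIidPl => w' w'k.
  by rewrite /at_ /mkset -(blockP wk w'k (leqnn n)).
by rewrite -[in RHS](_ : w n = v)//; exact: markov_cyl.
Qed.

Let escape (v : G) : set S := [set w | forall n, (0 < n)%N -> w n <> v].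

Let measurable_escape v : measurable (escape v).
Proof.
rewrite (_ : escape v = \bigcap_i [set w : S | (0 < i)%N -> w i <> v]).
  apply: bigcapT_measurable => i.
  exact: (measurable_coord i (fun u => (0 < i)%N -> u <> v)).
by apply/seteqP; split=> [w wy i _|w wy i]; exact: wy.
Qed.

Hypothesis Qescape : forall v, (0 < Q v (escape v))%E.

Let visits_summable x v : (\sum_(n <oo) Q x (at_ n v) < +oo)%E.
Proof.
pose A n := shift n @^-1` escape v `&` at_ n v.
have mA n : measurable (A n).
  apply: measurableI => //.
  by rewrite -[X in measurable X]setTI; exact: measurable_shift.
have tA : trivIset setT A.
  apply: ltn_trivIset => i j ij; apply/seteqP; split=> // w [[wi wiv] [_ wjv]].
  have := wi (i - j)%N; rewrite subn_gt0 => /(_ ij).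
  by rewrite /shift subnKC ?(ltnW ij).
have QvE : Q v (escape v) = (fine (Q v (escape v)))%:E.
  by rewrite fineK// fin_num_measure.
have : (Q x (\bigcup_n A n) <= 1)%E.
  by apply: probability_le1; exact: bigcupT_measurable.
rewrite measure_semi_bigcup//; last exact: bigcupT_measurable.
rewrite (_ : limn _ = \sum_(n <oo)
    ((fine (Q v (escape v)))%:E * Q x (at_ n v)))%E; last first.
  by apply: eq_eseriesr => n _; rewrite -QvE muleC; exact: markov.
rewrite nneseriesZl// -QvE => le1.
rewrite ltNge; apply/negP; rewrite leye_eq => /eqP oo; move: le1.
by rewrite oo gt0_muley// leye_eq.
Qed.

Let nonadj_null x n :
  (Q x).-negligible [set w : S | ~~ adj (w n) (w n.+1)].
Proof.
set X := [set w | _].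
rewrite -(bigcup_block n.+1 X); apply: negligible_bigcup => k.
have [->|/set0P[w [wk wX]]] := eqVneq (block n.+1 k `&` X) set0.
  exact: negligible_set0.
apply: (@negligibleS _ _ _ _ (cyl n.+1 w)).
  by rewrite -(cyl_block wk); exact: subIsetl.
apply/negligibleP => //; apply: (etrans (Q_cyl x n.+1 w)).
by rewrite big_ord_recr/= {2}/transition ifN ?mulr0.
Qed.

Lemma transient_path : exists2 w : nat -> G, (forall n, adj (w n) (w n.+1)) &
  forall x, finite_set [set n | w n = x].
Proof.
pose x : G := point.
pose h k := xget x [set v | g v = k].
have hg v : h (g v) = v.
  by apply: (svalP code); apply: (xgetPex x (ex_intro [set u | g u = g v] v _)).
pose N := (\bigcup_n [set w : S | ~~ adj (w n) (w n.+1)]) `|`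
          (\bigcup_k lim_sup_set (fun n => at_ n (h k))).
have [B [mB B0 NB]] : (Q x).-negligible N.
  apply: negligibleU; apply: negligible_bigcup => k; first exact: nonadj_null.
  apply/negligibleP.
    apply: bigcapT_measurable => n; exact: bigcup_measurable.
  by apply: lim_sup_set_cvg0 => [n|]; [exact: measurable_at|exact: visits_summable].
have [w nBw] : exists w, ~ B w.
  apply/existsNP => allB; have BT : B = setT by apply/seteqP; split.
  by move: B0; rewrite BT probability_setT => /eqP; rewrite onee_eq0.
have nNw : ~ N w by move/NB.
exists w => [n|v].
  by apply: contrapT => /negP nadj; apply: nNw; left; exists n.
apply: contrapT => winf; apply: nNw; right; exists (g v) => // n _.
rewrite hg; apply: contrapT => nw; apply: winf.
apply: (@sub_finite_set _ _ `I_n) => [j wj /=|]; last exact: finite_II.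
by rewrite ltnNge; apply/negP => nj; apply: nw; exists j.
Qed.

End transient_trajectory.

Record transientNetwork (R : realType) := TransientNetwork {
  network_of :> network R;
  network_transient : transient network_of
}.

Record halfTraj (R : realType) (G : transientNetwork R) := HalfTraj {
  half_traj :> nat -> G;
  half_traj_adj : forall n, adj (half_traj n) (half_traj n.+1);
  half_traj_fin : forall x, finite_set [set n | half_traj n = x]
}.

Record traj (R : realType) (G : transientNetwork R) := Traj {
  full_traj :> int -> G;
  full_traj_adj : forall n, adj (full_traj n) (full_traj (n + 1));
  full_traj_fin : forall x, finite_set [set n | full_traj n = x]
}.

Lemma halfTraj_inhabited (R : realType) (G : transientNetwork R) :
  exists w : halfTraj G, True.
Proof.
pose Q (x : G) := cid2 (network_transient x).
have [w wadj wfin] := @transient_path R G (fun x => s2val (Q x))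
  (fun x => s2valP (Q x)) (fun x => s2valP' (Q x)).
by exists (HalfTraj wadj wfin).
Qed.

Section trajectories.
Context (R : realType) (G : transientNetwork R).

HB.instance Definition _ := gen_eqMixin (halfTraj G).
HB.instance Definition _ := gen_choiceMixin (halfTraj G).
HB.instance Definition _ :=
  isPointed.Build (halfTraj G) (sval (cid (halfTraj_inhabited G))).

Let halfTraj_sets := coordinate_sets (@half_traj R G).
HB.instance Definition _ := @isMeasurable.Build (sigma_display halfTraj_sets)
  (halfTraj G) <<s halfTraj_sets >>
  (@sigma_algebra0 _ setT halfTraj_sets) (@sigma_algebraC _ halfTraj_sets)
  (@sigma_algebra_bigcup _ setT halfTraj_sets).

(* w |-> (w_|n|)_n maps W^+ to W, which is therefore nonempty. *)
Let mirror (w : halfTraj G) (n : int) : G := w `|n|%N.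

Let mirror_adj w n : adj (mirror w n) (mirror w (n + 1)).
Proof.
rewrite /mirror; case: n => n.
  by rewrite -PoszD addn1; exact: half_traj_adj.
have -> : Negz n + 1 = - n%:Z by rewrite NegzE -addn1 PoszD opprD subrK.
by rewrite abszN adj_sym; exact: half_traj_adj.
Qed.

Let mirror_fin w x : finite_set [set n | mirror w n = x].
Proof.
have Hw := half_traj_fin w x.
apply: (@sub_finite_set _ _
  ([set Posz n | n in [set n | w n = x]] `|` [set - Posz n | n in [set n | w n = x]])).
  move=> n /= wn; have [n0|n0] := leP 0 n.
    by left; exists `|n|%N => //; rewrite gez0_abs.
  by right; exists `|n|%N => //; rewrite ltz0_abs// opprK.
by rewrite finite_setU; split; exact: finite_image.
Qed.

HB.instance Definition _ := gen_eqMixin (traj G).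
HB.instance Definition _ := gen_choiceMixin (traj G).
HB.instance Definition _ := isPointed.Build (traj G)
  (Traj (mirror_adj point) (mirror_fin point)).

Let traj_sets := coordinate_sets (@full_traj R G).
HB.instance Definition _ := @isMeasurable.Build (sigma_display traj_sets)
  (traj G) <<s traj_sets >>
  (@sigma_algebra0 _ setT traj_sets) (@sigma_algebraC _ traj_sets)
  (@sigma_algebra_bigcup _ setT traj_sets).

Definition shifted (w w' : traj G) : bool :=
  `[< exists k : int, forall n : int, w (n + k) = w' n >].

Lemma shifted_refl : reflexive shifted.
Proof. by move=> w; apply/asboolP; exists 0 => n; rewrite addr0. Qed.

Lemma shifted_sym : symmetric shifted.
Proof.
suff s w w' : shifted w w' -> shifted w' w by move=> w w'; apply/idP/idP; exact: s.
by move=> /asboolP[k wk]; apply/asboolP; exists (- k) => n; rewrite -wk subrK.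
Qed.

Lemma shifted_trans : transitive shifted.
Proof.
move=> w2 w1 w3 /asboolP[k wk] /asboolP[l wl]; apply/asboolP; exists (l + k) => n.
by rewrite addrA wk wl.
Qed.

Canonical shifted_equiv := EquivRel shifted shifted_refl shifted_sym shifted_trans.

Definition trajClass := {eq_quot shifted}%qT.
HB.instance Definition _ := Choice.on trajClass.
HB.instance Definition _ := EqQuotient.on trajClass.

Definition to_class (w : traj G) : trajClass := \pi_trajClass%qT w.

HB.instance Definition _ := isPointed.Build trajClass (to_class point).

(* The quotient sigma-algebra. *)
Let class_sets := image_set_system setT to_class (@measurable _ (traj G)).

Let class_sigma : sigma_algebra setT class_sets.
Proof. exact/sigma_algebra_image/sigma_algebra_measurable. Qed.

Let class_sets0 : class_sets set0. Proof. by case: class_sigma. Qed.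
Let class_setsC A : class_sets A -> class_sets (~` A).
Proof. by case: class_sigma => _ + _ => /[apply]; rewrite setTD. Qed.
Let class_setsU (F : (set trajClass)^nat) : (forall i, class_sets (F i)) -> class_sets (\bigcup_i F i).
Proof. by case: class_sigma => _ _; apply. Qed.
HB.instance Definition _ := @isMeasurable.Build default_measure_display
  trajClass class_sets class_sets0 class_setsC class_setsU.

Let traj_after_adj (w : traj G) (k : int) n :
  adj (w (k + n%:Z)) (w (k + n.+1%:Z)).
Proof. by rewrite -addn1 PoszD addrA; exact: full_traj_adj. Qed.

Let traj_after_fin (w : traj G) (k : int) x :
  finite_set [set n : nat | w (k + n%:Z) = x].
Proof.
apply: (@finite_preimage nat int [set n | w n = x] (fun n => k + n%:Z)).
  by move=> i j _ _ /addrI[].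
exact: full_traj_fin.
Qed.

Definition traj_after (w : traj G) (k : int) : halfTraj G :=
  HalfTraj (traj_after_adj w k) (traj_after_fin w k).

Let traj_before_adj (w : traj G) (k : int) n :
  adj (w (k - n%:Z)) (w (k - n.+1%:Z)).
Proof.
rewrite adj_sym (_ : k - n%:Z = k - n.+1%:Z + 1); first exact: full_traj_adj.
by rewrite -addn1 PoszD opprD addrA subrK.
Qed.

Let traj_before_fin (w : traj G) (k : int) x :
  finite_set [set n : nat | w (k - n%:Z) = x].
Proof.
apply: (@finite_preimage nat int [set n | w n = x] (fun n => k - n%:Z)).
  by move=> i j _ _ /addrI/oppr_inj[].
exact: full_traj_fin.
Qed.

(* (w_{k+n})_{n <= 0}, read backwards in time: semi-infinite trajectories
   indexed by n <= 0 are encoded as elements of W^+ via n |-> -n. *)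
Definition traj_before (w : traj G) (k : int) : halfTraj G :=
  HalfTraj (traj_before_adj w k) (traj_before_fin w k).

Let theta_adj (w : halfTraj G) n : adj (w n.+1) (w n.+2).
Proof. exact: half_traj_adj. Qed.
Let theta_fin (w : halfTraj G) x : finite_set [set n | w n.+1 = x].
Proof.
apply: (@finite_preimage nat nat [set n | w n = x] succn).
  by move=> i j _ _ [].
exact: half_traj_fin.
Qed.

Definition theta (w : halfTraj G) : halfTraj G :=
  HalfTraj (theta_adj w) (theta_fin w).

(* W_K and W_K^* *)
Definition hitting (K : set G) : set (traj G) := [set w | exists n, K (w n)].

Definition hitting_class (K : set G) : set trajClass := to_class @` hitting K.

(* tau_K and lambda_K: for finite K and w in W_K, the infimum and the supremum
   are attained; otherwise the value is irrelevant. *)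
Definition first_hit (K : set G) (w : traj G) : int :=
  xget 0 [set n | K (w n) /\ forall m, K (w m) -> n <= m].

Definition last_hit (K : set G) (w : traj G) : int :=
  xget 0 [set n | K (w n) /\ forall m, K (w m) -> m <= n].

Definition out_traj (K : set G) (w : traj G) : halfTraj G * halfTraj G :=
  (traj_before w (first_hit K w), traj_after w (last_hit K w)).

Definition out_class (K : set G) (c : trajClass) :
    (halfTraj G * halfTraj G + trajClass)%type :=
  if `[< hitting_class K c >] then inl (out_traj K (repr c)) else inr c.

Lemma halfTraj_inj : injective (@half_traj R G).
Proof.
move=> [w wa wf] [w' wa' wf'] /= ww'; move: wa wf wa' wf'; rewrite ww' => wa wf wa' wf'.
by congr HalfTraj; exact: Prop_irrelevance.
Qed.

Let seq_min (s : seq int) : s != [::] ->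
  exists2 m, m \in s & forall n, n \in s -> m <= n.
Proof.
elim: s => // a [|b s] ih _.
  by exists a => [|n]; rewrite inE// => /eqP ->.
have [//|m ms mle] := ih.
have [am|ma] := leP a m; [exists a; first by rewrite mem_head|exists m].
- move=> n; rewrite in_cons => /predU1P[->//|/mle]; exact: le_trans.
- by rewrite in_cons ms orbT.
- by move=> n; rewrite in_cons => /predU1P[->|/mle//]; exact: ltW.
Qed.

Let hits_finite (K : set G) (w : traj G) : finite_set K ->
  finite_set [set n | K (w n)].
Proof.
move=> finK; rewrite (_ : mkset _ = \bigcup_(x in K) [set n | w n = x]).
  by apply: bigcup_finite => // x _; exact: full_traj_fin.
by apply/seteqP; split=> [n Kn|n [x Kx /= ->]//]; exists (w n).
Qed.

Lemma first_hitP (K : set G) (w : traj G) : finite_set K -> hitting K w ->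
  K (w (first_hit K w)) /\ forall m, K (w m) -> first_hit K w <= m.
Proof.
move=> /(hits_finite w)/finite_seqP[s sE] [n Kn].
have inE' m : K (w m) = (m \in s) by rewrite -[LHS]/([set n | K (w n)] m) sE.
have [|m ms mle] := @seq_min s; first by apply: contraPneq Kn => s0; rewrite inE' s0.
apply: (xgetPex 0 (ex_intro (fun n => K (w n) /\ forall m, K (w m) -> n <= m) m _)).
by split; [rewrite inE'|move=> k; rewrite inE'; exact: mle].
Qed.

Lemma last_hitP (K : set G) (w : traj G) : finite_set K -> hitting K w ->
  K (w (last_hit K w)) /\ forall m, K (w m) -> m <= last_hit K w.
Proof.
move=> /(hits_finite w)/finite_seqP[s sE] [n Kn].
have inE' m : K (w m) = (m \in s) by rewrite -[LHS]/([set n | K (w n)] m) sE.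
have [|m ms mle] := @seq_min [seq - i | i <- s].
  by apply: contraPneq Kn; rewrite inE'; case: s {sE inE'}.
apply: (xgetPex 0 (ex_intro (fun n => K (w n) /\ forall m, K (w m) -> m <= n) (- m) _)).
split; first by rewrite inE'; case/mapP: ms => i si ->; rewrite opprK.
by move=> k; rewrite inE' => ks; rewrite lerNr; apply: mle; exact: map_f.
Qed.

Lemma out_traj_shifted (K : set G) (w w' : traj G) : finite_set K ->
  hitting K w -> shifted w w' -> out_traj K w = out_traj K w'.
Proof.
move=> finK hw /asboolP[k wk].
have hw' : hitting K w' by case: hw => n Kn; exists (n - k); rewrite -wk subrK.
have [Kf fle] := first_hitP finK hw; have [Kf' fle'] := first_hitP finK hw'.
have [Kl lle] := last_hitP finK hw; have [Kl' lle'] := last_hitP finK hw'.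
have fE : first_hit K w = first_hit K w' + k.
  apply/eqP; rewrite eq_le fle ?wk//= -lerBrDr fle'// -wk subrK//.
have lE : last_hit K w = last_hit K w' + k.
  apply/eqP; rewrite eq_le lle ?wk// andbT -lerBlDr lle'// -wk subrK//.
congr pair; apply: halfTraj_inj; apply/funext => n /=.
  by rewrite fE addrAC wk.
by rewrite lE addrAC wk.
Qed.

(* The representative of a class used in [out_class] is immaterial. *)
Lemma out_classE (K : set G) (w : traj G) : finite_set K -> hitting K w ->
  out_class K (to_class w) = inl (out_traj K w).
Proof.
move=> finK hw; rewrite /out_class; case: asboolP => [_|[]]; last by exists w.
congr inl; apply/esym/out_traj_shifted => //.
by apply/(@eqquotP _ _ trajClass); rewrite reprK.
Qed.

Definition invariant_events : set (set (halfTraj G)) :=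
  [set A | measurable A /\ theta @^-1` A = A].

Definition arrow (A B : set (halfTraj G)) : set trajClass :=
  to_class @` [set w | A (traj_before w 0) /\ B (traj_after w 0)].

End trajectories.

(* The sigma-algebra of the disjoint union. *)
Section sum_measurable.
Context d1 d2 (T1 : measurableType d1) (T2 : measurableType d2).

HB.instance Definition _ := isPointed.Build (T1 + T2)%type (inl point).

Let sum_sets : set (set (T1 + T2)) :=
  [set D | measurable (inl @^-1` D) /\ measurable (inr @^-1` D)].
Let sum_sets0 : sum_sets set0.
Proof. by split; rewrite preimage_set0. Qed.
Let sum_setsC A : sum_sets A -> sum_sets (~` A).
Proof. by move=> [? ?]; split; rewrite preimage_setC; exact: measurableC. Qed.
Let sum_setsU (F : (set (T1 + T2))^nat) :
  (forall i, sum_sets (F i)) -> sum_sets (\bigcup_i F i).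
Proof.
by move=> mF; split; rewrite preimage_bigcup; apply: bigcupT_measurable => i;
  case: (mF i).
Qed.
HB.instance Definition _ := @isMeasurable.Build default_measure_display
  (T1 + T2)%type sum_sets sum_sets0 sum_setsC sum_setsU.
End sum_measurable.

Section point_measures.
Context (R : realType) d (T : measurableType d).

(* [None] contributes nothing, so that finite sums of Dirac masses are point
   measures as well. *)
Definition dirac_opt (o : option T) : {measure set T -> \bar R} :=
  if o is Some t then \d_t else mzero.

Definition point_sum (u : nat -> option T) : {measure set T -> \bar R} :=
  mseries (fun i => dirac_opt (u i)) 0.

(* A point measure is kept as a set function on all subsets (like \d_t), so
   that it determines the multiplicity of each point and Leibniz equality is
   equality of point measures. *)
Record pointMeasure := PointMeasure {
  point_measure :> set T -> \bar R;
  point_measureP : exists u, point_measure = point_sum u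
}.

HB.instance Definition _ := gen_eqMixin pointMeasure.
HB.instance Definition _ := gen_choiceMixin pointMeasure.
HB.instance Definition _ := isPointed.Build pointMeasure
  (PointMeasure (ex_intro _ (fun=> None) erefl)).

(* Generators of the sigma-algebra of the maps w |-> ev w D, D measurable. *)
Definition evaluation_sets (S : Type) (ev : S -> set T -> \bar R) :
    set (set S) :=
  [set E | exists2 D, measurable D &
           exists2 B : set (\bar R), measurable B & E = [set w | B (ev w D)]].

Let pm_sets := evaluation_sets point_measure.
HB.instance Definition _ := @isMeasurable.Build (sigma_display pm_sets)
  pointMeasure <<s pm_sets >> (@sigma_algebra0 _ setT pm_sets)
  (@sigma_algebraC _ pm_sets) (@sigma_algebra_bigcup _ setT pm_sets).

End point_measures.

Definition point_atoms (R : realType) d (T : measurableType d)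
  (m : pointMeasure R T) : nat -> option T := sval (cid (point_measureP m)).

Section interlacements.
Context (R : realType) (G : transientNetwork R).

Record configuration := Configuration {
  config :> pointMeasure R (trajClass G);
  config_fin : forall K : set G, finite_set K ->
    (config (hitting_class K) < +oo)%E
}.

Let config0_fin (K : set G) : finite_set K ->
  ((point : pointMeasure R (trajClass G)) (hitting_class K) < +oo)%E.
Proof.
move=> _ /=; rewrite /point /= /mseries eseries0//.
Qed.

HB.instance Definition _ := gen_eqMixin configuration.
HB.instance Definition _ := gen_choiceMixin configuration.
HB.instance Definition _ := isPointed.Build configuration
  (Configuration config0_fin).

Let config_sets := evaluation_sets (fun w : configuration => point_measure w).
HB.instance Definition _ := @isMeasurable.Build (sigma_display config_sets)
  configuration <<s config_sets >> (@sigma_algebra0 _ setT config_sets)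
  (@sigma_algebraC _ config_sets) (@sigma_algebra_bigcup _ setT config_sets).

Definition out_config (K : set G) (w : configuration) :
    pointMeasure R (halfTraj G * halfTraj G + trajClass G)%type :=
  PointMeasure (ex_intro _ (fun i => omap (out_class K) (point_atoms w i)) erefl).

(* The enumeration of the atoms used in [out_config] is immaterial. *)
Lemma out_configE (K : set G) (w : configuration) D :
  out_config K w D = w (out_class K @^-1` D).
Proof.
rewrite {2}/point_measure; case: w => -[m mP] mfin /=.
rewrite /out_config /point_atoms /=; case: cid => u /= ->.
by apply: eq_eseriesr => i _; case: (u i).
Qed.

(* sigma(Out_K) is the preimage under Out_K of the sigma-algebra of point
   measures. *)
Definition nonlocal_events : set (set configuration) :=
  [set E | forall K : set G, finite_set K ->
           g_sigma_algebra_preimage (out_config K) E].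

Section intensity.
Variable P : G -> probability (halfTraj G) R.

(* tau_K^+ = +oo *)
Definition no_return (K : set G) : set (halfTraj G) :=
  [set w | forall n, (0 < n)%N -> ~ K (w n)].

Definition equilibrium (K : set G) (x : G) : R :=
  if x \in K then total_conductance x * fine (P x (no_return K)) else 0.

(* P_x[A | tau_K^+ = +oo]; equal to 0 when the conditioning event is null, which
   for x in K is the case e_K(x) = 0. *)
Definition cond_no_return (K : set G) (x : G) (A : set (halfTraj G)) : R :=
  fine (P x (A `&` no_return K)) / fine (P x (no_return K)).

(* m is nu_K *)
Definition hitting_intensity (K : set G) (m : set (traj G) -> \bar R) :=
  forall x A B, measurable A -> measurable B ->
    m [set w | [/\ A (traj_before w 0), w 0 = x & B (traj_after w 0)]] =
    (cond_no_return K x A * equilibrium K x * fine (P x B))%:E.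

Definition interlacement_intensity (nu : set (trajClass G) -> \bar R) :=
  forall K : set G, finite_set K ->
    exists2 nuK : {measure set (traj G) -> \bar R}, hitting_intensity K nuK &
      forall D, measurable D ->
        nu (D `&` hitting_class K) = nuK (@to_class R G @^-1` D).

End intensity.

(* Pr is the law of a Poisson point process with intensity nu: Poisson counts
   (infinite a.s. on sets of infinite intensity), independent on disjoint
   sets. *)
Definition poisson_process (nu : set (trajClass G) -> \bar R)
    (Pr : set configuration -> \bar R) :=
  [/\ forall D (k : nat), measurable D -> (nu D < +oo)%E ->
        Pr [set w | w D = k%:R%:E] =
        (expR (- fine (nu D)) * fine (nu D) ^+ k / k`!%:R)%:E,
      forall D, measurable D -> nu D = +oo%E -> Pr [set w | w D = +oo%E] = 1%E &
      forall n (D : 'I_n -> set (trajClass G)) (B : 'I_n -> set (\bar R)),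
        (forall i, measurable (D i)) -> (forall i, measurable (B i)) ->
        trivIset setT D ->
        Pr (\bigcap_i [set w | B i (w (D i))]) =
        (\prod_(i < n) Pr [set w | B i (w (D i))])%E].

End interlacements.

Section pure_atomicity.
Context (R : realType) (T : Type) (J : set (set T)) (mu : set T -> \bar R).

Definition atomic (A : set T) :=
  [/\ J A, (0 < mu A)%E &
      forall B, J B -> B `<=` A -> mu B = mu A \/ mu B = 0%E].

Definition purely_atomic := exists C : set (set T),
  [/\ countable C, C `<=` atomic, trivIset C id & \bigcup_(A in C) A = setT].

End pure_atomicity.

(* Main.v *)
Require Import Defs.
From mathcomp Require Import all_boot all_order all_algebra.
From mathcomp Require Import generic_quotient.
From mathcomp Require Import all_classical all_reals all_analysis.
From mathcomp Require Import measurable_realfun.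
From mathcomp Require Import ring lra.

Set Implicit Arguments.
Unset Strict Implicit.
Unset Printing Implicit Defensive.

Import Order.TTheory GRing.Theory Num.Theory.
Local Open Scope classical_set_scope.
Local Open Scope ring_scope.

(* For a fixed configuration w, whether w + delta_c belongs to a non-local
   event E depends on the trajectory c only through Out_K(c), for every finite
   K; so it is a function of the two ends of c that is invariant under the
   shift at each end. Under nu the ends are absolutely continuous with respect
   to P_x \x P_x, so by atomicity of T_MC this function is constant on A -> B
   for atoms A and B: all trajectories of type (A, B) affect E in the same way.

   Mecke's formula E[X(D) ; E] = \int_D Pr(w + delta_c \in E) nu(dc) then shows
   that E[X(D) ; E /\ L] / nu(D) is the same for all D inside A -> B that do
   not interfere with a local event L. If nu(A -> B) is infinite, D can be taken
   so large that X(D) / nu(D) is close to 1, and the common value is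
   Pr(E /\ L). This gives (k+1) Pr(E, X(D) = k+1, L) = nu(D) Pr(E, X(D) = k, L),
   so conditionally on E the counts still form a Poisson process of intensity
   nu. Hence E is independent of all events, in particular of itself. *)

(** * Trajectories and the measure of A -> B *)

(** The count of a set [D0] is Poisson with mean m = nu(D0), and E|X(D0) - m| <= m / t as soon as
    t^2 <= m. Divided by m this error is 1/t, uniformly over the event on which the count is
    averaged. Since t is arbitrary when nu(A -> B) is infinite, approximate identities yield an
    exact recurrence. If nu(A -> B) were positive and finite, the number of trajectories of type A
    -> B would be a non-degenerate Poisson variable that can be read off Out_K for every K.

    The comparison works inside one arrow only, whereas a measurable set may meet many. All counts
    are therefore taken over sets lying in a single arrow between atoms; there are countably many
    such arrows, and disjoint families of such sets still determine the law.

    A set of classes modulo time shift has to be viewed as a set of pairs of half-trajectories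
    before Fubini applies. A fixed path joins the past to the future, and non-locality makes its
    choice immaterial. *)

Section coordinates.
Context (R : realType) (G : transientNetwork R).

Lemma vertex_code : exists (g : G -> nat) (h : nat -> G), cancel g h.
Proof.
have /countable_injP[g gi] := vertex_countable G.
exists g, (fun k => xget point [set v | g v = k]) => v.
have := xgetPex point (ex_intro [set u | g u = g v] v erefl).
by move/gi; apply; rewrite inE.
Qed.

Lemma measurable_half_coord n (B : set G) :
  measurable [set w : halfTraj G | B (w n)].
Proof. by apply: sub_sigma_algebra; exists n, B. Qed.

Lemma measurable_traj_coord n (B : set G) :
  measurable [set w : traj G | B (w n)].
Proof. by apply: sub_sigma_algebra; exists n, B. Qed.

Section measurable_into.
Context d (T : measurableType d).

Lemma measurable_fun_half (f : T -> halfTraj G) :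
  (forall n (B : set G), measurable [set t | B (f t n)]) ->
  measurable_fun setT f.
Proof.
move=> mf; apply: (@measurability _ _ T (halfTraj G) setT f
  (coordinate_sets (@half_traj R G)) erefl).
by move=> _ [_ [i [B ->]] <-]; rewrite setTI; exact: mf.
Qed.

Lemma measurable_fun_traj (f : T -> traj G) :
  (forall n (B : set G), measurable [set t | B (f t n)]) ->
  measurable_fun setT f.
Proof.
move=> mf; apply: (@measurability _ _ T (traj G) setT f
  (coordinate_sets (@full_traj R G)) erefl).
by move=> _ [_ [i [B ->]] <-]; rewrite setTI; exact: mf.
Qed.

End measurable_into.

Lemma measurable_theta : measurable_fun setT (@theta R G).
Proof. by apply: measurable_fun_half => n B; exact: (measurable_half_coord n.+1 B). Qed.

Lemma measurable_traj_before k : measurable_fun setT ((@traj_before R G)^~ k).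
Proof.
by apply: measurable_fun_half => n B; exact: (measurable_traj_coord (k - n%:Z) B).
Qed.

Lemma measurable_traj_after k : measurable_fun setT ((@traj_after R G)^~ k).
Proof.
by apply: measurable_fun_half => n B; exact: (measurable_traj_coord (k + n%:Z) B).
Qed.

Lemma halfTrajP (w w' : halfTraj G) : w =1 w' -> w = w'.
Proof. by move/funext/halfTraj_inj. Qed.

Lemma measurable_to_class : measurable_fun setT (@to_class R G).
Proof. by move=> _ D mD; exact: mD. Qed.

Lemma measurable_classP (D : set (trajClass G)) :
  measurable (@to_class R G @^-1` D) <-> measurable D.
Proof.
split => mD; last by rewrite -[X in measurable X]setTI; exact: measurable_to_class.
by rewrite -[X in measurable X]setTI in mD; exact: mD.
Qed.

Lemma to_class_surj (c : trajClass G) : exists w, to_class w = c.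
Proof. by exists (repr c); rewrite /to_class reprK. Qed.

Lemma to_classP (w w' : traj G) : to_class w = to_class w' <->
  exists k : int, forall n : int, w (n + k) = w' n.
Proof.
split => [/(@eqquotP _ _ (trajClass G))/asboolP//|ex].
by apply/(@eqquotP _ _ (trajClass G)); apply/asboolP.
Qed.

Lemma hitting_preimage K : @to_class R G @^-1` hitting_class K = hitting K.
Proof.
apply/seteqP; split=> [w [w' [n Kn] /to_classP[k wk]]|w hw]; last by exists w.
by exists (n - k); rewrite -wk subrK.
Qed.

Lemma measurable_hitting_class K : measurable (hitting_class (G := G) K).
Proof.
apply/measurable_classP; rewrite hitting_preimage.
rewrite (_ : hitting K = \bigcup_n [set w : traj G | K (w n)]).
  apply: countable_bigcupT_measurable => // n; exact: measurable_traj_coord.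
by apply/seteqP; split=> [w [n Kn]|w [n _ Kn]]; exists n.
Qed.

Lemma invariant_theta (A : set (halfTraj G)) u :
  invariant_events A -> A (theta u) <-> A u.
Proof. by move=> [_ AE]; rewrite -[in X in _ <-> X]AE. Qed.

Lemma traj_before_pred (w : traj G) k :
  traj_before w (k - 1) = theta (traj_before w k).
Proof.
by apply: halfTrajP => n /=; rewrite -addn1 PoszD opprD addrA addrAC.
Qed.

Lemma traj_after_succ (w : traj G) k :
  traj_after w (k + 1) = theta (traj_after w k).
Proof. by apply: halfTrajP => n /=; rewrite -addrA -PoszD add1n. Qed.

Lemma invariant_before (A : set (halfTraj G)) (w : traj G) k :
  invariant_events A -> A (traj_before w k) <-> A (traj_before w 0).
Proof.
move=> iA; case: k => n; last rewrite NegzE; elim: n => [|n ih].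
- by [].
- by rewrite -ih -(invariant_theta _ iA) -traj_before_pred -addn1 PoszD addrK.
- by rewrite -[in X in _ <-> X](invariant_theta _ iA) -traj_before_pred sub0r.
- rewrite -ih -[in X in _ <-> X](invariant_theta _ iA) -traj_before_pred.
  by rewrite -[n.+2]addn1 PoszD opprD.
Qed.

Lemma invariant_after (A : set (halfTraj G)) (w : traj G) k :
  invariant_events A -> A (traj_after w k) <-> A (traj_after w 0).
Proof.
move=> iA; case: k => n; last rewrite NegzE; elim: n => [|n ih].
- by [].
- by rewrite -ih -[in X in _ <-> X](invariant_theta _ iA) -traj_after_succ -addn1 PoszD.
- by rewrite -(invariant_theta _ iA) -traj_after_succ addNr.
- by rewrite -ih -(invariant_theta _ iA) -traj_after_succ -[n.+2]addn1 PoszD opprD addrNK.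
Qed.

(** Invariance makes both conditions independent of the time at which the trajectory is cut, so the
    set on the right is a union of shift classes. *)
Lemma arrow_preimage (A B : set (halfTraj G)) :
  invariant_events A -> invariant_events B ->
  @to_class R G @^-1` arrow A B =
  [set w | A (traj_before w 0) /\ B (traj_after w 0)].
Proof.
move=> iA iB; apply/seteqP; split=> [w [w' [Aw Bw] /to_classP[k wk]]|w [Aw Bw]];
  last by exists w.
split.
- apply/(invariant_before w (- k) iA).
  suff -> : traj_before w (- k) = traj_before w' 0 by [].
  by apply: halfTrajP => n /=; rewrite -wk addrAC addNr.
- apply/(invariant_after w (- k) iB).
  suff -> : traj_after w (- k) = traj_after w' 0 by [].
  by apply: halfTrajP => n /=; rewrite -wk addrAC addNr.
Qed.

Lemma measurable_arrow (A B : set (halfTraj G)) :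
  invariant_events A -> invariant_events B -> measurable (arrow A B).
Proof.
move=> iA iB; apply/measurable_classP; rewrite arrow_preimage//.
apply: measurableI.
- by rewrite -[X in measurable X]setTI; apply: measurable_traj_before => //; case: iA.
- by rewrite -[X in measurable X]setTI; apply: measurable_traj_after => //; case: iB.
Qed.

(** For a non-local event and a fixed configuration, the trajectories whose addition leads into the
    event form such a set: see [nonlocal_out_invariant]. *)
Definition out_invariant (S : set (trajClass G)) := forall K, finite_set K ->
  forall c c', out_class K c = out_class K c' -> S c -> S c'.

(** As w is in K at time [a], the first visit lies in the common past, where the two trajectories
    differ only by the time shift from [a] to [a']. *)
Lemma first_hit_before K (w w' : traj G) a a' : finite_set K ->
  traj_before w a = traj_before w' a' -> K (w a) ->
  traj_before w (first_hit K w) = traj_before w' (first_hit K w').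
Proof.
move=> fK ww' Kwa.
have wE n : w (a - n%:Z) = w' (a' - n%:Z) by rewrite -[LHS]/(traj_before w a n) ww'.
have Kwa' : K (w' a') by move: Kwa; have := wE 0%N; rewrite !subr0 => ->.
have [Kf fle] := first_hitP fK (ex_intro (fun n => K (w n)) a Kwa).
have [Kf' fle'] := first_hitP fK (ex_intro (fun n => K (w' n)) a' Kwa').
have wE' n : n <= a -> w n = w' (n - a + a').
  rewrite -subr_ge0 => n0; have := wE `|a - n|%N; rewrite gez0_abs// subKr => ->.
  by rewrite opprB addrC.
have fa : first_hit K w <= a by exact: fle.
have f'a : first_hit K w' <= a' by exact: fle'.
have E : first_hit K w' = first_hit K w - a + a'.
  apply/eqP; rewrite eq_le fle' -?wE'//= -lerBrDr lerBlDr.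
  apply: fle; rewrite wE'; first by rewrite addrK subrK.
  by rewrite gerDr subr_le0.
apply: halfTrajP => n /=; rewrite wE'.
  by rewrite E (addrAC _ (- n%:Z)) (addrAC _ (- n%:Z)).
by rewrite (le_trans _ fa)// gerBl.
Qed.

Lemma last_hit_after K (w w' : traj G) b b' : finite_set K ->
  traj_after w b = traj_after w' b' -> K (w b) ->
  traj_after w (last_hit K w) = traj_after w' (last_hit K w').
Proof.
move=> fK ww' Kwb.
have wE n : w (b + n%:Z) = w' (b' + n%:Z) by rewrite -[LHS]/(traj_after w b n) ww'.
have Kwb' : K (w' b') by move: Kwb; have := wE 0%N; rewrite !addr0 => ->.
have [Kl lle] := last_hitP fK (ex_intro (fun n => K (w n)) b Kwb).
have [Kl' lle'] := last_hitP fK (ex_intro (fun n => K (w' n)) b' Kwb').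
have wE' n : b <= n -> w n = w' (n - b + b').
  rewrite -subr_ge0 => n0; have := wE `|n - b|%N.
  rewrite gez0_abs// (addrC b) subrK => ->.
  by rewrite (addrC b').
have bl : b <= last_hit K w by exact: lle.
have bl' : b' <= last_hit K w' by exact: lle'.
have E : last_hit K w' = last_hit K w - b + b'.
  apply/eqP; rewrite eq_le lle' -?wE'// andbT -lerBlDr lerBrDr.
  apply: lle; rewrite wE'; first by rewrite addrK subrK.
  by rewrite lerDr subr_ge0.
apply: halfTrajP => n /=; rewrite wE'.
  by rewrite E (addrAC _ n%:Z) (addrAC _ n%:Z).
by rewrite (le_trans bl)// lerDl.
Qed.

(* The first and the last visit to {w_a, w_b} only see the two ends. *)
Lemma out_invariant_ends S (w w' : traj G) a a' b b' : out_invariant S ->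
  traj_before w a = traj_before w' a' -> traj_after w b = traj_after w' b' ->
  S (to_class w) -> S (to_class w').
Proof.
move=> iS wa wb; pose K := [set w a; w b].
have fK : finite_set K by rewrite /K finite_setU; split; exact: finite_set1.
apply: (iS K fK); rewrite !out_classE//.
- congr (inl (_, _)).
    by apply: first_hit_before wa _ => //; left.
  by apply: last_hit_after wb _ => //; right.
- exists a'; left; have := congr1 (fun u : halfTraj G => u 0%N) wa.
  by rewrite /= !subr0 => ->.
- by exists a; left.
Qed.

End coordinates.

(** * Trajectories with prescribed ends *)

Section gluing.
Context (R : realType) (G : transientNetwork R).

Definition joining_path (x y : G) : seq G := s2val (cid2 (adj_conn x y)).

Lemma joining_pathP x y : path (@adj R G) x (joining_path x y).
Proof. by rewrite /joining_path; case: cid2. Qed.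

Lemma last_joining_path x y : last x (joining_path x y) = y.
Proof. by rewrite /joining_path; case: cid2. Qed.

(** [p] occupies the times 1 to [size p]. When it leads from [u 0] to [v 0], the vertex at time
    [size p] is already [v 0], so [v] itself is read from index 1 on. *)
Definition glue_along (p : seq G) (u v : halfTraj G) (n : int) : G :=
  match n with
  | Posz 0 => u 0%N
  | Posz m.+1 => if (m < size p)%N then nth point p m else v (m.+1 - size p)%N
  | Negz m => u m.+1
  end.

Lemma glue_along_adj p (u v : halfTraj G) :
  path (@adj R G) (u 0%N) p -> last (u 0%N) p = v 0%N ->
  forall n, adj (glue_along p u v n) (glue_along p u v (n + 1)).
Proof.
move=> /(pathP point) pp lp; case=> [[|m]|[|m]].
- rewrite add0r /=; case: p pp lp => [|x p] pp /= lp; last exact: (pp 0%N).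
  by rewrite lp; exact: half_traj_adj.
- rewrite -PoszD addn1 /=; case: ltnP => mp.
    case: ltnP => mp'; first exact: (pp m.+1).
    have mE : size p = m.+1 by apply/eqP; rewrite eqn_leq mp mp'.
    rewrite mE subSnn (_ : nth _ _ _ = v 0%N) ?half_traj_adj//.
    by rewrite -lp (last_nth point) mE.
  by rewrite ltnNge leqW//= (subSn (leqW mp)) half_traj_adj.
- by rewrite /= adj_sym; exact: half_traj_adj.
- rewrite (_ : Negz m.+1 + 1 = Negz m).
    by rewrite /= adj_sym; exact: half_traj_adj.
  by rewrite !NegzE -[m.+2]addn1 PoszD opprD addrNK.
Qed.

Lemma glue_along_fin p u v x : finite_set [set n | glue_along p u v n = x].
Proof.
apply: (@sub_finite_set _ _ ((Negz \o predn) @` [set n | u n = x] `|`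
  (Posz @` `I_(size p).+1 `|` (Posz \o addn (size p)) @` [set n | v n = x]))).
  case=> [[|m]|m] /=; [by right; left; exists 0%N| |by move=> um; left; exists m.+1].
  right; move: H; case: ltnP => mp E; [left; exists m.+1 => //; exact: leqW|].
  by right; exists (m.+1 - size p)%N => //=; rewrite subnKC// (leq_trans mp).
rewrite !finite_setU; split; first exact/finite_image/half_traj_fin.
by split; apply: finite_image; [exact: finite_II|exact: half_traj_fin].
Qed.

Definition glue (u v : halfTraj G) : traj G :=
  Traj (glue_along_adj (joining_pathP (u 0%N) (v 0%N)) (last_joining_path _ _))
       (glue_along_fin (joining_path (u 0%N) (v 0%N)) u v).

Lemma traj_before_glue u v : traj_before (glue u v) 0 = u.
Proof.
apply: halfTrajP => n.
rewrite -[LHS]/(glue_along (joining_path (u 0%N) (v 0%N)) u v (0 - n%:Z)) sub0r.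
by case: n => [|n]; rewrite ?oppr0 -?NegzE.
Qed.

Lemma traj_after_glue u v :
  traj_after (glue u v) (size (joining_path (u 0%N) (v 0%N))) = v.
Proof.
set p := joining_path _ _; apply: halfTrajP => n /=.
rewrite -/p; case: {2}(size p + n)%N (erefl (size p + n)%N) => [|m] mE.
  move/eqP: mE; rewrite addn_eq0 => /andP[/eqP/size0nil p0 /eqP ->].
  by rewrite p0 /=; have := last_joining_path (u 0%N) (v 0%N); rewrite -/p p0.
rewrite mE /=; case: ltnP => mp; last by rewrite -mE addKn.
have n0 : n = 0%N.
  by apply/eqP; rewrite -leqn0 -(leq_add2l (size p)) addn0 mE.
by rewrite n0 -(last_joining_path (u 0%N) (v 0%N)) -/p (last_nth point)
  -[size p]addn0 -n0 mE.
Qed.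

(** The joining path depends on its two endpoints only, and there are countably many pairs of
    vertices. On each piece a coordinate of the glued trajectory is constant or a coordinate of [u]
    or [v]. *)
Lemma measurable_glue :
  measurable_fun setT (fun uv : halfTraj G * halfTraj G => glue uv.1 uv.2).
Proof.
apply: measurable_fun_traj => n B.
have m1 k (C : set G) :
    measurable [set uv : halfTraj G * halfTraj G | C (uv.1 k)].
  rewrite -[X in measurable X]setTI.
  exact: (@measurable_fst _ _ (halfTraj G) (halfTraj G) measurableT _
    (measurable_half_coord k C)).
have m2 k (C : set G) :
    measurable [set uv : halfTraj G * halfTraj G | C (uv.2 k)].
  rewrite -[X in measurable X]setTI.
  exact: (@measurable_snd _ _ (halfTraj G) (halfTraj G) measurableT _
    (measurable_half_coord k C)).
rewrite (_ : mkset _ = \bigcup_(xy : G * G)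
   ([set uv : halfTraj G * halfTraj G | uv.1 0%N = xy.1] `&`
    [set uv : halfTraj G * halfTraj G | uv.2 0%N = xy.2] `&`
    [set uv | B (glue_along (joining_path xy.1 xy.2) uv.1 uv.2 n)])); last first.
  apply/seteqP; split=> [uv Buv|uv [[x y] _ [[/= <- <-]]]//].
  by exists (uv.1 0%N, uv.2 0%N).
apply: countable_bigcupT_measurable => [|[x y]].
  by rewrite -setXTT; apply: countableX; exact: vertex_countable.
apply: measurableI.
  by apply: measurableI; [exact: (m1 0%N (eq^~ x))|exact: (m2 0%N (eq^~ y))].
case: n => [[|m]|m] /=; [exact: m1| |exact: m1].
by case: ltnP => _; [exact: (m1 0%N (fun=> B _))|exact: m2].
Qed.

Variables (S : set (trajClass G)).
Hypotheses (mS : measurable S) (iS : out_invariant S).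

Definition ends : set (halfTraj G * halfTraj G) :=
  [set uv | S (to_class (glue uv.1 uv.2))].

Lemma measurable_ends : measurable ends.
Proof.
rewrite -[X in measurable X]setTI.
exact: (measurable_glue measurableT ((measurable_classP S).2 mS)).
Qed.

Lemma ends_traj w k l : ends (traj_before w k, traj_after w l) <-> S (to_class w).
Proof.
rewrite /ends /mkset/=; set g := glue _ _; split; apply: out_invariant_ends => //.
- exact: traj_before_glue.
- exact: traj_after_glue.
- by apply: esym; exact: traj_before_glue.
- by apply: esym; exact: traj_after_glue.
Qed.

(** Cutting the past of the glued trajectory one step earlier does not change its class. *)
Lemma ends_thetal u v : ends (theta u, v) <-> ends (u, v).
Proof.
have := ends_traj (glue u v) (0 - 1) (size (joining_path (u 0%N) (v 0%N))).
by rewrite traj_before_pred traj_before_glue traj_after_glue.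
Qed.

Lemma ends_thetar u v : ends (u, theta v) <-> ends (u, v).
Proof.
have := ends_traj (glue u v) 0 ((size (joining_path (u 0%N) (v 0%N)))%:Z + 1).
by rewrite traj_after_succ traj_before_glue traj_after_glue.
Qed.

End gluing.

(** * Null invariant events do not depend on the starting point *)

Section markov_property.
Context (R : realType) (G : transientNetwork R).

Definition cylinder n (y : nat -> G) : set (halfTraj G) :=
  [set w | forall i, (i <= n)%N -> w i = y i].

Definition cylinders : set (set (halfTraj G)) :=
  [set A | A = set0 \/ exists n y, A = cylinder n y].

Lemma measurable_cylinder n y : measurable (cylinder n y).
Proof.
rewrite (_ : cylinder n y = \bigcap_i [set w | (i <= n)%N -> w i = y i]).
  apply: bigcapT_measurable => i.
  exact: (measurable_half_coord i (fun v => (i <= n)%N -> v = y i)).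
by apply/seteqP; split=> [w wy i _|w wy i]; exact: wy.
Qed.

Lemma cylindersI : setI_closed cylinders.
Proof.
move=> A B [->|[n [y ->]]]; first by left; rewrite set0I.
move=> [->|[m [z ->]]]; first by left; rewrite setI0.
have [E|/set0P[w [wy wz]]] := eqVneq (cylinder n y `&` cylinder m z) set0.
  by left.
right; exists (maxn n m), w; apply/seteqP; split=> [w' [w'y w'z] i|w' w'w].
  by rewrite leq_max => /orP[lei|lei]; [rewrite w'y ?wy|rewrite w'z ?wz].
by split=> i lei; rewrite w'w ?(leq_max, lei, orbT)//; [exact: wy|exact: wz].
Qed.

Lemma cylinders_gen : measurable = <<s cylinders >> :> set (set (halfTraj G)).
Proof.
have [g [h gh]] := vertex_code G.
apply/seteqP; split; last first.
  apply: smallest_sub; first exact: sigma_algebra_measurable.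
  by move=> A [->|[n [y ->]]]; [exact: measurable0|exact: measurable_cylinder].
apply: smallest_sub; first exact: smallest_sigma_algebra.
move=> _ [i [B ->]].
(* Cylinders of a given length are indexed by finite sequences of vertex codes, which makes the
   union below countable. *)
pose c (s : seq nat) := cylinder i (fun j => h (nth 0%N s j)).
rewrite (_ : mkset _ = \bigcup_(s in [set s : seq nat | B (h (nth 0%N s i))]) c s).
  have := @countable_bigcupT_measurable _ (g_sigma_algebraType cylinders) (seq nat)
    (fun s => if `[< B (h (nth 0%N s i)) >] then c s else set0) (countableP _).
  rewrite (_ : \bigcup_i0 _ =
    \bigcup_(s in [set s : seq nat | B (h (nth 0%N s i))]) c s); first apply.
    move=> s; case: ifP => _; last exact: measurable0.
    by apply: sub_sigma_algebra; right; exists i; eexists.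
  rewrite [RHS]bigcup_mkcond; apply: eq_bigcupr => s _.
  suff -> : (s \in [set s | B (h (nth 0%N s i))]) = `[< B (h (nth 0%N s i)) >] by [].
  by apply/idP/asboolP; rewrite inE.
apply/seteqP; split=> [w Bw|w [s Bs ws] /=]; last by rewrite ws.
have wE j : (j <= i)%N -> nth 0%N [seq g (w j) | j <- iota 0 i.+1] j = g (w j).
  by move=> ji; rewrite (nth_map 0%N) ?size_iota// nth_iota.
by exists [seq g (w j) | j <- iota 0 i.+1] => [|j ji] /=; rewrite wE// gh.
Qed.

Variable P : G -> probability (halfTraj G) R.
Hypothesis P_markov : forall x : G, markov_law (@half_traj R G) x (P x).

Lemma P_cylinder x n y : P x (cylinder n y) =
  ((x == y 0%N)%:R * \prod_(i < n) transition (y i) (y i.+1))%:E.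
Proof. exact: P_markov. Qed.

(** [nth y [:: x]] is the sequence x, y, y, ...; the event is w_0 = x, w_1 = y. *)
Definition first_step (x y : G) := cylinder 1 (nth y [:: x]).

Lemma markov_step x y A : measurable A ->
  P x (@theta R G @^-1` A `&` first_step x y) = ((transition x y)%:E * P y A)%E.
Proof.
move=> mA.
have P1 : P x (first_step x y) = (transition x y)%:E.
  by rewrite P_cylinder /= eqxx mul1r big_ord1.
have t0 : 0 <= transition x y by rewrite -lee_fin -P1.
have m1 : measurable (first_step x y) by exact: measurable_cylinder.
pose m : {measure set (halfTraj G) -> \bar R} := mscale (NngNum t0) (P y).
have mE B : m B = ((transition x y)%:E * P y B)%E by [].
pose m' := pushforward (mrestr (P x) m1) (@theta R G).
have [m2 m2E] : exists m2 : {measure set (halfTraj G) -> \bar R}, m2 = m' :> (_ -> _).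
  by exists (measure_function_pushforward__canonical__measure_function_Measure
    (mrestr (P x) m1) (@measurable_theta R G)).
have [g [h gh]] := vertex_code G.
rewrite -[LHS]/(m' A) -mE -m2E.
apply: (measure_unique cylinders (fun k => cylinder 0 (fun=> h k))) => //.
- exact: cylinders_gen.
- exact: cylindersI.
- by move=> k; right; exists 0%N, (fun=> h k).
- apply/seteqP; split=> // w _; exists (g (w 0%N)) => // i.
  by rewrite leqn0 => /eqP ->; rewrite gh.
- move=> _ [->|[n [z ->]]]; first by rewrite !measure0.
  rewrite m2E mE /m' /pushforward /mrestr P_cylinder -EFinM.
  have [yz|yz] := eqVneq y (z 0%N); last first.
    rewrite mul0r mulr0 (_ : _ `&` _ = set0) ?measure0//.
    apply/seteqP; split=> // w [/(_ 0%N erefl) /= wz].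
    by move=> /(_ 1%N erefl) /= wy; move: yz; rewrite -wy wz eqxx.
  rewrite (_ : _ `&` _ = cylinder n.+1 (fun i => if i is j.+1 then z j else x)).
    by rewrite P_cylinder /= eqxx !mul1r big_ord_recl /= -yz.
  apply/seteqP; split=> [w [wz wy] [|i] lei|w wu].
  - exact: (wy 0%N).
  - exact: wz.
  - split=> [i lei|[|[|i]] lei //]; first exact: (wu i.+1).
      exact: (wu 0%N).
    by rewrite (wu 1%N).
- move=> k; rewrite m2E /m' /pushforward /mrestr.
  rewrite (le_lt_trans (probability_le1 _ _)) ?ltry//.
  apply: measurableI => //; rewrite -[X in measurable X]setTI.
  by apply: measurable_theta => //; exact: measurable_cylinder.
Qed.

Lemma transition_gt0 (x y : G) : adj x y -> 0 < transition x y.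
Proof.
move=> xy; rewrite /transition xy divr_gt0 ?conductance_gt0//.
rewrite /total_conductance (fsbigD1 y)//=; last exact: adj_lf.
rewrite ltr_pwDl ?conductance_gt0// fsumr_ge0// => z [xz _].
exact/ltW/conductance_gt0.
Qed.

(** Each step of a path from x to y has positive probability and preserves an invariant event. This
    is needed because the atoms are given for one starting point, while nu involves the chain from
    every vertex. *)
Lemma invariant_null x y A : invariant_events A -> P x A = 0%E -> P y A = 0%E.
Proof.
move=> iA; have [mA AE] := iA; have [p + <-] := adj_conn x y.
elim: p x => // z p ih x /= /andP[xz pz] Px0; apply: ih pz _.
have : (P x (@theta R G @^-1` A `&` first_step x z) <= 0)%E.
  rewrite -Px0 AE le_measure ?inE//; apply: measurableI => //.
  exact: measurable_cylinder.
rewrite markov_step// pmule_rle0 ?lte_fin ?transition_gt0// => Pz0.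
by apply/eqP; rewrite eq_le Pz0 measure_ge0.
Qed.

End markov_property.

(** * Zero-one law for nu inside an arrow between atoms *)

Section arrow_zero_one.
Context (R : realType) (G : transientNetwork R).
Variable P : G -> probability (halfTraj G) R.
Hypothesis P_markov : forall x : G, markov_law (@half_traj R G) x (P x).
Variable nu : {measure set (trajClass G) -> \bar R}.
Hypothesis nu_intensity : interlacement_intensity P nu.

Let at0 (x : G) : set (traj G) := [set w | w 0 = x].

Let measurable_at0 x : measurable (at0 x).
Proof. exact: (measurable_traj_coord 0 (eq^~ x)). Qed.

Let measurable_no_return (K : set G) : measurable (no_return K).
Proof.
rewrite (_ : no_return K = \bigcap_n [set w : halfTraj G | (0 < n)%N -> ~ K (w n)]).
  apply: bigcapT_measurable => n.
  exact: (measurable_half_coord n (fun v => (0 < n)%N -> ~ K v)).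
by apply/seteqP; split=> [w wy i _|w wy i]; exact: wy.
Qed.

Let rectangle (x : G) (A B : set (halfTraj G)) : set (traj G) :=
  [set w | [/\ A (traj_before w 0), w 0 = x & B (traj_after w 0)]].

Let at0E x : at0 x = rectangle x setT setT.
Proof. by apply/seteqP; split=> [w wx|w []//]. Qed.

Let hitting_at0 (K : set G) (m : {measure set (traj G) -> \bar R}) x :
  hitting_intensity P K m -> m (at0 x) = (equilibrium P K x)%:E.
Proof.
move=> mK; rewrite at0E mK// /cond_no_return setTI probability_setT mulr1.
rewrite /equilibrium; case: ifPn => _; rewrite ?mulr0//.
by have [->|n0] := eqVneq (fine (P x (no_return K))) 0; rewrite ?mulr0// divff// mul1r.
Qed.

Let hitting_off (K : set G) (m : {measure set (traj G) -> \bar R}) :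
  hitting_intensity P K m -> m.-negligible [set w | ~ K (w 0)].
Proof.
move=> mK; have [g [h gh]] := vertex_code G.
apply: (@negligibleS _ _ _ _
    (\bigcup_k (if `[< K (h k) >] then set0 else at0 (h k)))).
  move=> w /= nKw; exists (g (w 0)) => //; rewrite gh.
  by case: asboolP => // _; rewrite /at0/=.
apply: negligible_bigcup => k; case: asboolP => nK; first exact: negligible_set0.
apply/negligibleP; first exact: measurable_at0.
apply: (etrans (hitting_at0 _ mK)); rewrite /equilibrium ifN//.
by apply/negP; rewrite inE.
Qed.

(** nu_K only charges trajectories that are in K at time 0, so the mass is the finite sum of e_K
    over K. *)
Lemma intensity_hitting_fin (K : set G) :
  finite_set K -> (nu (hitting_class K) < +oo)%E.
Proof.
move=> fK; have [m mK mE] := nu_intensity fK.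
rewrite -[X in nu X]setTI mE//= preimage_setT.
have -> : [set: traj G] = \bigcup_(x in K) at0 x `|` [set w | ~ K (w 0)].
  apply/seteqP; split=> // w _; have [Kw|] := pselect (K (w 0)); last by right.
  by left; exists (w 0).
have mK0 : measurable (\bigcup_(x in K) at0 x).
  by apply: fin_bigcup_measurable => // x _; exact: measurable_at0.
rewrite measureU0//; last first.
- apply/negligibleP; last exact: hitting_off.
  exact: (measurable_traj_coord 0 (fun x => ~ K x)).
- exact: (measurable_traj_coord 0 (fun x => ~ K x)).
rewrite measure_fin_bigcup//; last first.
  by move=> x y _ _ [w [<- <-]].
rewrite fsbig_finite//=; apply: lte_sum_pinfty => x _.
by rewrite (hitting_at0 _ mK) ltry.
Qed.

(* nu_{x} is a multiple of P_x(. , no return) \x P_x. *)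
Let intensity_null_at (Z : set (halfTraj G * halfTraj G)) (N : set (halfTraj G)) x D :
  measurable Z -> measurable N -> P x N = 0%E ->
  (forall u, ~ N u -> P x (xsection Z u) = 0%E) ->
  measurable D ->
  (forall w, D (to_class w) -> Z (traj_before w 0, traj_after w 0)) ->
  nu (D `&` hitting_class [set x]) = 0%E.
Proof.
move=> mZ mN PN0 PZ0 mD DZ; have [m mK mE] := nu_intensity (finite_set1 x).
rewrite mE//.
pose psi (w : traj G) := (traj_before w 0, traj_after w 0).
have mpsi : measurable_fun setT psi.
  apply: measurable_fun_pair; first exact: measurable_traj_before.
  exact: measurable_traj_after.
have mpsiV X : measurable X -> measurable (psi @^-1` X).
  by move=> mX; rewrite -[Y in measurable Y]setTI; exact: mpsi.
apply: measure_negligible.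
  by rewrite -[X in measurable X]setTI; exact: measurable_to_class.
apply: (@negligibleS _ _ _ _ ((psi @^-1` Z `&` at0 x) `|` [set w | ~ [set x] (w 0)])).
  move=> w /= Dw; have [wx|] := pselect (w 0 = x); last by right.
  by left; split=> //; exact: DZ.
apply: negligibleU; last exact: hitting_off.
apply/negligibleP; first by apply: measurableI; [exact: mpsiV|exact: measurable_at0].
pose m' := pushforward (mrestr m (measurable_at0 x)) psi.
have [m2 m2E] : exists m2 : {measure set (halfTraj G * halfTraj G) -> \bar R},
    m2 = m' :> (_ -> _).
  by exists (measure_function_pushforward__canonical__measure_function_Measure
    (mrestr m (measurable_at0 x)) mpsi).
have tc : 0 <= total_conductance x.
  by apply: fsumr_ge0 => z xz; exact/ltW/conductance_gt0.
pose m1 : {finite_measure set (halfTraj G) -> \bar R} :=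
  mscale (NngNum tc) (mrestr (P x) (measurable_no_return [set x])).
have m1E A : m1 A = ((total_conductance x)%:E * P x (A `&` no_return [set x]))%E by [].
rewrite -[LHS]/(m' Z) -m2E -(@product_measure_unique _ _ _ _ _ m1 (P x))//.
  rewrite [LHS]/product_measure1 (ge0_negligible_integral mN)//=.
  - by apply: integral0_eq => u [_ /PZ0].
  - exact: measurable_fun_xsection.
  - apply/eqP; rewrite -measure_le0 [leLHS]m1E.
    rewrite mule_ge0_le0 ?lee_fin// -PN0 le_measure ?inE//.
    exact: measurableI.
move=> A B mA mB; rewrite -[RHS]/((total_conductance x)%:E *
  P x (A `&` no_return [set x]) * P x B)%E m2E /m' /pushforward /mrestr.
rewrite [X in m X](_ : _ = rectangle x A B); last first.
  by apply/seteqP; split=> w /=; [move=> [[? ?] ?]|move=> [? ? ?]].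
rewrite mK// /cond_no_return /equilibrium ifT ?inE//.
have PE C : measurable C -> P x C = (fine (P x C))%:E.
  by move=> mC; rewrite fineK// fin_num_measure.
rewrite (PE B)// (PE (A `&` _)); last exact: measurableI.
rewrite -!EFinM; congr (_ * _)%:E.
(* If x has escape probability 0, the conditional probability is 0 by the convention for division,
   and P x (A, no return) vanishes too by monotonicity. *)
have [n0|n0] := eqVneq (fine (P x (no_return [set x]))) 0; last first.
  by rewrite mulrCA divfK.
rewrite n0 !mulr0; apply/esym; rewrite (_ : fine _ = 0) ?mulr0//.
apply/eqP; rewrite eq_le fine_ge0// andbT -n0 fine_le ?fin_num_measure//.
- exact: measurableI.
- by rewrite le_measure ?inE//; exact: measurableI.
Qed.

(** Every trajectory hits the singleton of its vertex at time 0, so countably many pieces, each null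
    by Fubini, cover [D]. *)
Lemma intensity_null (Z : set (halfTraj G * halfTraj G)) D :
  measurable Z ->
  (forall x, exists2 N, measurable N /\ P x N = 0%E &
    forall u, ~ N u -> P x (xsection Z u) = 0%E) ->
  measurable D ->
  (forall w, D (to_class w) -> Z (traj_before w 0, traj_after w 0)) ->
  nu D = 0%E.
Proof.
move=> mZ Z0 mD DZ; have [g [h gh]] := vertex_code G.
apply/negligibleP => //.
apply: (@negligibleS _ _ _ _ (\bigcup_k (D `&` hitting_class [set h k]))).
  move=> c Dc; have [w wc] := to_class_surj c; exists (g (w 0)) => //; split=> //.
  by exists w => //; exists 0; rewrite gh.
apply: negligible_bigcup => k; have [N [mN N0] ZN] := Z0 (h k).
apply/negligibleP; last exact: (intensity_null_at mZ mN N0).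
by apply: measurableI => //; exact: measurable_hitting_class.
Qed.

Lemma invariantI (A B : set (halfTraj G)) :
  invariant_events A -> invariant_events B -> invariant_events (A `&` B).
Proof.
by move=> [mA AE] [mB BE]; split; [exact: measurableI|rewrite preimage_setI AE BE].
Qed.

Lemma invariantD (A B : set (halfTraj G)) :
  invariant_events A -> invariant_events B -> invariant_events (A `\` B).
Proof.
move=> [mA AE] [mB BE]; split; first exact: measurableD.
by rewrite setDE preimage_setI -preimage_setC AE BE.
Qed.

Lemma atomic_invariant (x : G) A B : atomic (@invariant_events R G) (P x) A ->
  invariant_events B -> P x (A `&` B) = 0%E \/ P x (A `\` B) = 0%E.
Proof.
move=> [iA A0 atA] iB; have [mA _] := iA; have [mB _] := iB.
have [E|] := atA _ (invariantI iA iB) (@subIsetl _ A B); last by left.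
right; have DI : P x A = (P x (A `\` B) + P x (A `&` B))%E by exact: measureDI.
have fA : P x A \is a fin_num by rewrite fin_num_measure.
by have := congr1 (fun r => r - P x A)%E DI; rewrite E addeK// subee.
Qed.

(** Atomicity is used twice. For a fixed past u the section of [ends S] is invariant, hence null or
    full in B; the set U of pasts for which it is null is again invariant, hence null or full in
    A. *)
Lemma arrow_zero_one x A B S :
  atomic (@invariant_events R G) (P x) A -> atomic (@invariant_events R G) (P x) B ->
  measurable S -> out_invariant S ->
  nu (arrow A B `&` S) = 0%E \/ nu (arrow A B `\` S) = 0%E.
Proof.
move=> atA atB mS iS; have [iA _ _] := atA; have [iB _ _] := atB.
have [mA AE] := iA; have [mB BE] := iB.
have mE := measurable_ends mS.
have iE u : invariant_events (xsection (ends S) u).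
  split; first exact: measurable_xsection.
  by apply/seteqP; split=> v /xsectionP/(ends_thetar iS)/xsectionP.
pose f u := P x (B `&` xsection (ends S) u).
pose U := [set u | f u = 0%E].
have iU : invariant_events U.
  split; last first.
    apply/seteqP; split=> u; rewrite /U /f /mkset => <-; congr (P x (_ `&` _));
      by apply/seteqP; split=> v /xsectionP/(ends_thetal iS)/xsectionP.
  have := @measurable_fun_xsection _ _ _ _ _ (P x) _
    (measurableI _ _ (measurableX (@measurableT _ (halfTraj G)) mB) mE).
  move=> /(_ measurableT [set 0%E] (emeasurable_set1 _)).
  rewrite setTI; congr (measurable _); apply/funext => u; rewrite /U /f /=.
  by rewrite xsectionI in_xsectionX// inE.
(* The exceptional set and the sections are invariant, so being null for the start x passes to every
   start y. *)
have null (X : set (halfTraj G * halfTraj G)) N D : measurable X ->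
    (forall u, invariant_events (xsection X u)) ->
    invariant_events N -> P x N = 0%E ->
    (forall u, A u -> ~ N u -> P x (B `&` xsection X u) = 0%E) -> measurable D ->
    (forall w, D (to_class w) -> X (traj_before w 0, traj_after w 0)) ->
    nu (arrow A B `&` D) = 0%E.
  move=> mX iX iN N0 NX mD DX; apply: (@intensity_null ((A `*` B) `&` X)).
  - by apply: measurableI => //; exact: measurableX.
  - move=> y; exists N.
      by split; [case: iN|exact: (invariant_null P_markov y iN N0)].
    move=> u nNu; have [Au|nAu] := pselect (A u).
      rewrite xsectionI in_xsectionX ?inE//.
      exact: (invariant_null P_markov y (invariantI iB (iX u)) (NX u Au nNu)).
    rewrite (_ : xsection _ u = set0) ?measure0//.
    by apply/seteqP; split=> // v /xsectionP [[]].
  - by apply: measurableI => //; exact: measurable_arrow.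
  - move=> w [ABw Dw]; split; last exact: DX.
    by have : (@to_class R G @^-1` arrow A B) w by []; rewrite arrow_preimage.
have CE u : xsection (~` ends S) u = ~` xsection (ends S) u.
  by rewrite !xsectionE preimage_setC.
(* If U is null in A, almost every past in A has a section that fills B, and it is the complement of
   [ends S] that is null. *)
have [E|E] := atomic_invariant atA iU; [right|left].
- apply: (null (~` ends S) (A `&` U)) => //.
  + exact: measurableC.
  + by move=> u; rewrite CE -setTD; apply: invariantD => //; split.
  + exact: invariantI.
  + move=> u Au nN; have [fu|] := atomic_invariant atB (iE u); first by case: nN.
    by rewrite CE setDE.
  + exact: measurableC.
  + by move=> w nSw /(ends_traj iS).
- apply: (null (ends S) (A `\` U)) => //.
  + exact: invariantD.
  + by move=> u Au nN; apply: contrapT => fu; apply: nN.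
  + by move=> w /(ends_traj iS w 0 0).
Qed.

(** S is either null or full in the arrow, so the ratio nu(D [&] S) / nu(D) is the same for D and
    D'. The cross-multiplied form also covers zero and infinite intensities. *)
Lemma arrow_proportional x A B S D D' :
  atomic (@invariant_events R G) (P x) A -> atomic (@invariant_events R G) (P x) B ->
  measurable S -> out_invariant S -> measurable D -> measurable D' ->
  D `<=` arrow A B -> D' `<=` arrow A B ->
  (nu D' * nu (D `&` S) = nu D * nu (D' `&` S))%E.
Proof.
move=> atA atB mS iS mD mD' DAB D'AB; have [iA _ _] := atA; have [iB _ _] := atB.
have mAB := measurable_arrow iA iB.
have [E|E] := arrow_zero_one atA atB mS iS.
- have null X : measurable X -> X `<=` arrow A B -> nu (X `&` S) = 0%E.
    move=> mX XAB; apply: subset_measure0 E; first exact: measurableI.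
      exact: measurableI.
    exact: setSI.
  by rewrite !null// !mule0.
- have null X : measurable X -> X `<=` arrow A B -> nu (X `&` S) = nu X.
    move=> mX XAB; rewrite [RHS](measureDI _ _ mS)//.
    rewrite (@subset_measure0 _ _ _ _ (X `\` S) (arrow A B `\` S)) ?add0e//.
    - exact: measurableD.
    - exact: measurableD.
    - exact: setSD.
  by rewrite !null// muleC.
Qed.

End arrow_zero_one.

(** * Configurations and Mecke's formula *)

(** Bounded partial sums of natural numbers attain their maximum, and all later terms vanish. *)
Lemma nneseries_nat (R : realType) (b : nat -> nat) :
  (\sum_(i <oo) ((b i)%:R%:E : \bar R) < +oo)%E ->
  exists k, (\sum_(i <oo) ((b i)%:R%:E : \bar R) = k%:R%:E)%E.
Proof.
set S := (\sum_(i <oo) _)%E => Soo.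
have b0 i : (0 <= ((b i)%:R%:E : \bar R))%E by rewrite lee_fin ler0n.
have part n : (\sum_(0 <= i < n) ((b i)%:R%:E : \bar R) =
    (\sum_(0 <= i < n) b i)%:R%:E)%E.
  by rewrite natr_sum sumEFin.
have S0 : (0 <= S)%E by exact: nneseries_ge0.
have SE : S = (fine S)%:E by rewrite fineK// ge0_fin_numE.
pose p k := `[< exists n, (\sum_(0 <= i < n) b i)%N = k >].
have p0 : exists k, p k by exists 0%N; apply/asboolP; exists 0%N; rewrite big_geq.
have pM k : p k -> (k <= Num.truncn (fine S))%N.
  move=> /asboolP[n <-]; rewrite truncn_ge_nat ?fine_ge0//.
  by rewrite -lee_fin -SE -part; exact: nneseries_lim_ge.
have [K /asboolP[N NK] maxK] := ex_maxnP p0 pM.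
exists K; rewrite /S (nneseries_split 0 N)// part add0n NK eseries0 ?adde0// => i Ni _.
suff -> : b i = 0%N by [].
apply/eqP; rewrite -leqn0 -(leq_add2l K) addn0.
have : (\sum_(0 <= i < i.+1) b i <= K)%N by apply: maxK; apply/asboolP; exists i.+1.
apply: leq_trans; rewrite big_nat_recr//= leq_add2r -NK.
by rewrite [leqRHS](big_cat_nat (leq0n N) Ni) leq_addr.
Qed.

Section point_measures.
Context (R : realType) d (T : measurableType d).

Lemma pointMeasureP (m m' : pointMeasure R T) :
  point_measure m = point_measure m' -> m = m'.
Proof.
case: m m' => [m mP] [m' mP'] /= mm'; move: mP mP'; rewrite mm' => mP mP'.
by congr PointMeasure; exact: Prop_irrelevance.
Qed.

Lemma point_measure_measure (m : pointMeasure R T) :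
  exists mu : {measure set T -> \bar R}, mu = m :> (set T -> \bar R).
Proof. by have [u mu] := point_measureP m; exists (point_sum R u). Qed.

Lemma point_sum_nat (u : nat -> option T) D : exists b : nat -> nat,
  point_sum R u D = (\sum_(i <oo) ((b i)%:R%:E : \bar R))%E.
Proof.
exists (fun i => if u i is Some t then nat_of_bool (t \in D) else 0%N).
apply: eq_eseriesr => i _; case: (u i) => [t|] //=.
Qed.

Lemma point_measure_nat (m : pointMeasure R T) D : (m D < +oo)%E ->
  exists k, m D = k%:R%:E.
Proof.
have [u ->] := point_measureP m; have [b ->] := point_sum_nat u D; exact: nneseries_nat.
Qed.

Definition add_atom_seq (c : T) (u : nat -> option T) (i : nat) : option T :=
  if i is j.+1 then u j else Some c.

Lemma point_sum_add c u D :
  point_sum R (add_atom_seq c u) D = (\d_c D + point_sum R u D)%E.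
Proof.
rewrite [LHS]nneseries_recl//.
rewrite -nneseries_addn//; congr (_ + _)%E; apply: eq_eseriesr => i _.
by rewrite addn1.
Qed.

End point_measures.

(** * Adding a trajectory to a configuration *)

Section configurations.
Context (R : realType) (G : transientNetwork R).
Local Notation W := (trajClass G).

Let add_pm (c : W) (w : configuration G) : pointMeasure R W :=
  PointMeasure (ex_intro _ (add_atom_seq c (point_atoms w)) erefl).

Let add_pmE c w D : add_pm c w D = (\d_c D + w D)%E.
Proof.
rewrite [LHS]point_sum_add; congr (_ + _)%E.
by rewrite /point_atoms; case: cid => /= u ->.
Qed.

Let add_pm_fin c w (K : set G) : finite_set K ->
  (add_pm c w (hitting_class K) < +oo)%E.
Proof.
by move=> fK; rewrite add_pmE lte_add_pinfty ?config_fin// diracE ltry.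
Qed.

Definition add_point (c : W) (w : configuration G) : configuration G :=
  Configuration (@add_pm_fin c w).

Lemma add_pointE c w D : add_point c w D = (\d_c D + w D)%E.
Proof. exact: add_pmE. Qed.

Lemma nonlocal_out_invariant (E : set (configuration G)) w :
  nonlocal_events E -> out_invariant [set c | E (add_point c w)].
Proof.
move=> nE K /nE[B _ <-] c c' cc' /= [_ Bc]; split=> //=.
suff <- : out_config K (add_point c w) = out_config K (add_point c' w) by [].
apply: pointMeasureP; apply/funext => D; rewrite !out_configE !add_pointE.
rewrite !diracE; congr ((nat_of_bool _)%:R%:E + _)%E.
by apply/idP/idP; rewrite !inE /preimage/= cc'.
Qed.

Lemma measurable_config (D : set W) : measurable D ->
  measurable_fun setT (fun w : configuration G => w D).
Proof.
move=> mD _ B mB; rewrite setTI; apply: sub_sigma_algebra.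
by exists D => //; exists B.
Qed.

Lemma measurable_into_config d (T : measurableType d) (f : T -> configuration G) :
  (forall D, measurable D -> measurable_fun setT (fun t => f t D)) ->
  measurable_fun setT f.
Proof.
move=> mf; apply: (@measurability _ _ T (configuration G) setT f
  (evaluation_sets (fun w : configuration G => point_measure w)) erefl).
move=> _ [_ [D mD [B mB ->]] <-].
exact: (mf D mD measurableT B mB).
Qed.

Lemma measurable_add_point : measurable_fun setT
  (fun wc : configuration G * W => add_point wc.2 wc.1).
Proof.
apply: measurable_into_config => D mD.
rewrite (_ : (fun _ => _) = (fun wc : configuration G * W =>
  (\1_D wc.2)%:E + (wc.1 : configuration G) D)%E); last first.
  by apply/funext => wc; rewrite add_pointE diracE indicE.
apply: emeasurable_funD.
  apply/measurable_EFinP; apply: measurableT_comp => //.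
exact: (measurableT_comp (measurable_config mD)).
Qed.

(** Take K empty: no trajectory hits it, so Out_K keeps every class and its counts are counts of the
    configuration. *)
Lemma nonlocal_measurable (E : set (configuration G)) :
  nonlocal_events E -> measurable E.
Proof.
move=> /(_ set0 (finite_set0 _))[B mB <-].
have mout : measurable_fun setT (out_config (set0 : set G)).
  apply: (@measurability _ _ _ (pointMeasure R _) setT _
    (evaluation_sets (@point_measure R _ _)) erefl).
  move=> _ [_ [D [_ mD] [C mC ->]] <-].
  have -> : setT `&` out_config set0 @^-1` [set m | C (m D)] =
      setT `&` (fun w : configuration G => w (inr @^-1` D)) @^-1` C.
    congr (_ `&` _); apply/funext => w; rewrite /preimage /mkset out_configE.
    congr (C (w _)); apply/funext => c; rewrite /preimage /mkset /out_class.
    by case: asboolP => // -[w' [n []]].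
  exact: (measurable_config mD).
exact: mout.
Qed.

End configurations.

Lemma measure_fin_union (R : realFieldType) d (T : ringOfSetsType d)
    (mu : {content set T -> \bar R}) (I : finType) (J : pred I) (C : I -> set T) :
  (forall i, J i -> measurable (C i)) -> trivIset J C ->
  mu (\bigcup_(i in [set i | J i]) C i) = (\sum_(i | J i) mu (C i))%E.
Proof.
move=> mC tC; have JE : [set i | J i] = [set` enum J].
  by apply/seteqP; split=> i /=; rewrite mem_enum.
rewrite -[RHS]big_enum fsbig_seq ?enum_uniq// -JE.
by apply: measure_fin_bigcup => //; rewrite JE; exact: finite_seq.
Qed.

(** * Measures determined by counts on disjoint sets *)

Section finite_dimensional.
Context (R : realType) (G : transientNetwork R).
Local Notation W := (trajClass G).
Local Notation Omega := (configuration G).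

Definition count_event (J : finType) (D : J -> set W) (k : J -> nat) : set Omega :=
  [set w | forall j, w (D j) = (k j)%:R%:E].

Definition count_at (D : set W) (k : nat) : set Omega := [set w | w D = k%:R%:E].

Lemma measurable_count_at D k : measurable D -> measurable (count_at D k).
Proof.
move=> mD; rewrite -[X in measurable X]setTI.
exact: (measurable_config mD measurableT (emeasurable_set1 _)).
Qed.

Lemma count_eventE (J : finType) (D : J -> set W) (k : J -> nat) :
  count_event D k = \bigcap_(j in [set: J]) count_at (D j) (k j).
Proof. by apply/seteqP; split=> [w wk j _|w wk j]; exact: wk. Qed.

Lemma measurable_count_event (J : finType) (D : J -> set W) k :
  (forall j, measurable (D j)) -> measurable (count_event D k).
Proof.
move=> mD; rewrite count_eventE; apply: fin_bigcap_measurable => //.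
by move=> j _; exact: measurable_count_at.
Qed.

Lemma config_fin_union (w : Omega) (I : finType) (J : pred I) (C : I -> set W) :
  (forall i, J i -> measurable (C i)) -> trivIset J C ->
  w (\bigcup_(i in [set i | J i]) C i) = (\sum_(i | J i) w (C i))%E.
Proof.
have [mu <-] := point_measure_measure w; exact: measure_fin_union.
Qed.

Lemma config_bigcup (w : Omega) (F : nat -> set W) :
  (forall i, measurable (F i)) -> trivIset setT F ->
  w (\bigcup_i F i) = (\sum_(i <oo) w (F i))%E.
Proof.
have [mu <-] := point_measure_measure w => mF tF.
by rewrite measure_semi_bigcup//; exact: bigcupT_measurable.
Qed.

Lemma config_ge0 (w : Omega) D : (0 <= w D)%E.
Proof. by have [mu <-] := point_measure_measure w. Qed.

Lemma config_nat (w : Omega) D : (w D < +oo)%E -> exists k, w D = k%:R%:E.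
Proof. exact: point_measure_nat. Qed.

Lemma EFin_nat_inj (m n : nat) : m%:R%:E = n%:R%:E :> \bar R -> m = n.
Proof. by move=> [] /eqP; rewrite eqr_nat => /eqP. Qed.

Variables (Gs : set (set W)) (X : set W).
Hypothesis Gs_measurable : Gs `<=` measurable.
Hypothesis GsI : forall A B, Gs A -> measurable B -> Gs (A `&` B).
Hypothesis Gs_fin : forall A (w : Omega), Gs A -> (w A < +oo)%E.
Hypothesis GsX : Gs X.
Variable F : nat -> set W.
Hypothesis GsF : forall i, Gs (F i).
Hypothesis F_cover : \bigcup_i F i = setT.

(** Every family contains X, so that the cells it generates split X, as [mu12] demands; the pieces
    [count_at X n] belong to [Pi] and have finite mass. [Gs] will be the bounded sets for Mecke's
    formula, and the bounded sets inside one arrow for the zero-one law. *)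
Let Pi : set (set Omega) := [set A | exists (J : finType) (D : J -> set W) k,
  [/\ forall j, Gs (D j), exists j, D j = X & A = count_event D k]].

Let PiI : setI_closed Pi.
Proof.
move=> _ _ [J1 [D1 [k1 [G1 [j1 j1X] ->]]]] [J2 [D2 [k2 [G2 _ ->]]]].
exists (J1 + J2)%type, (fun j => match j with inl j => D1 j | inr j => D2 j end),
  (fun j => match j with inl j => k1 j | inr j => k2 j end); split.
- by case.
- by exists (inl j1).
- apply/seteqP; split=> [w [w1 w2] [j|j]|w wk]; [exact: w1|exact: w2|split=> j].
    exact: (wk (inl j)).
  exact: (wk (inr j)).
Qed.

Let Pi_measurable : Pi `<=` measurable.
Proof.
move=> _ [J [D [k [GD _ ->]]]]; apply: measurable_count_event => j.
exact: Gs_measurable.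
Qed.

Let Pi_gen : measurable = <<s Pi>> :> set (set Omega).
Proof.
apply/seteqP; split; last first.
  apply: smallest_sub; first exact: sigma_algebra_measurable.
  exact: Pi_measurable.
apply: smallest_sub; first exact: smallest_sigma_algebra.
move=> _ [D mD [B mB ->]].
pose OP : measurableType _ := g_sigma_algebraType Pi.
(* A count of C alone enters [Pi] only together with a count of X, hence the union over the values m
   of the latter. *)
have at_Pi C n : Gs C -> measurable (count_at C n : set OP).
  move=> GC; rewrite (_ : count_at C n = \bigcup_m
    count_event (fun b : bool => if b then C else X) (fun b => if b then n else m)).
    apply: bigcupT_measurable => m; apply: sub_sigma_algebra.
    by exists bool, (fun b : bool => if b then C else X), (fun b => if b then n else m);
      split=> //; [case|exists false].
  apply/seteqP; split=> [w wC|w [m _ /(_ true)]//].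
  by have [m wX] := config_nat (Gs_fin w GsX); exists m => // -[].
have mC C : Gs C -> measurable_fun setT (fun w : OP => (w : Omega) C).
  move=> GC _ Y mY; rewrite setTI.
  rewrite (_ : _ @^-1` _ = \bigcup_(n in [set n | Y n%:R%:E]) count_at C n).
    by apply: bigcup_measurable => n _; exact: at_Pi.
  apply/seteqP; split=> [w|w [n Yn wn]]; rewrite /preimage /mkset.
    by have [n E] := config_nat (Gs_fin w GC); rewrite E => Yn; exists n.
  by rewrite (wn : _ = _).
have GFD i : Gs (seqDU F i `&` D).
  apply: GsI => //; rewrite /seqDU setDE; apply: GsI => //; apply: measurableC.
  by apply: bigsetU_measurable => j _; exact: Gs_measurable.
have : measurable_fun setT (fun w : OP => (w : Omega) D).
  rewrite (_ : (fun _ => _) =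
      fun w : OP => (\sum_(i <oo | i \in predT)
        (w : Omega) (seqDU F i `&` D))%E); last first.
    apply/funext => w; rewrite -[in LHS](setTI D) -F_cover seqDU_bigcup_eq setI_bigcupl.
    rewrite config_bigcup//; first by move=> i; exact: Gs_measurable.
    by apply: trivIset_setIr; exact: trivIset_seqDU.
  apply: ge0_emeasurable_sum => [k w _ _|k _]; first exact: config_ge0.
  exact: mC.
by move=> /(_ measurableT B mB); rewrite setTI.
Qed.

Variables mu1 mu2 : {measure set Omega -> \bar R}.
Hypothesis mu1_fin : forall n, (mu1 (count_at X n) < +oo)%E.
Hypothesis mu12 : forall (I : finType) (C : I -> set W) (k : I -> nat),
  (forall i, Gs (C i)) -> trivIset setT C ->
  (exists J : pred I, X = \bigcup_(i in [set i | J i]) C i) ->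
  mu1 (count_event C k) = mu2 (count_event C k).

Let mu12_Pi A : Pi A -> mu1 A = mu2 A.
Proof.
move=> [J [D [k [GD [jX jXE] ->]]]].
pose label c : {set J} := [set j | `[< D j c >]]%SET.
(* The cell outside all [D j] is emptied, since it need not belong to [Gs]. *)
pose C (S : {set J}) : set W := [set c | S != finset.set0 /\ label c = S].
have CD (S : {set J}) j : j \in S -> C S `<=` D j.
  by move=> jS c [_ cS]; apply/asboolP; move: jS; rewrite -cS inE.
have mD j : measurable (D j) by exact: Gs_measurable.
have mC0 S : measurable [set c | label c = S].
  rewrite (_ : mkset _ =
      \bigcap_(j in [set: J]) (if j \in S then D j else ~` D j)).
    apply: fin_bigcap_measurable => // j _.
    by case: ifP => _; [exact: mD|apply: measurableC; exact: mD].
  apply/seteqP; split=> [c <- j _|c cS].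
    by rewrite inE; case: asboolP.
  apply/setP => j; rewrite inE; have := cS j Logic.I.
  by case: ifP => _; case: asboolP.
have GC S : Gs (C S).
  have [->|/finset.set0Pn[j jS]] := eqVneq S finset.set0.
    rewrite (_ : C _ = X `&` set0); first by apply: GsI.
    by rewrite setI0; apply/seteqP; split=> // c [/eqP].
  rewrite (_ : C _ = D j `&` [set c | label c = S]); first exact: GsI.
  apply/seteqP; split=> c; first by move=> cS; split; [exact: CD cS|case: cS].
  by move=> [_ cS]; split=> //; apply/finset.set0Pn; exists j.
have mC S : measurable (C S) by exact: Gs_measurable.
have tC : trivIset setT C by move=> S S' _ _ [c [[_ <-] [_ <-]]].
have DE j : D j = \bigcup_(S in [set S : {set J} | j \in S]) C S.
  apply/seteqP; split=> [c Dc|c [S /= jS] /CD]; last exact.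
  have jc : j \in label c by rewrite inE; exact/asboolP.
  by exists (label c) => //; split=> //; apply/finset.set0Pn; exists j.
have wD w j : (w : Omega) (D j) = (\sum_(S : {set J} | j \in S) w (C S))%E.
  by rewrite {1}DE config_fin_union//; exact: sub_trivIset tC.
pose ok (f : {ffun {set J} -> nat}) :=
  [forall j, \sum_(S : {set J} | j \in S) f S == k j]%N.
(* [pickle_inv] decodes exact codes only, so each f occurs for a single n and the events [B n] are
   disjoint. *)
pose unp (n : nat) : option {ffun {set J} -> nat} := pickle_inv n.
pose B n := if unp n is Some f then
  if ok f then count_event C f else set0 else set0.
have AE : count_event D k = \bigcup_n B n.
  apply/seteqP; split=> [w wk|w [n _]].
    have /choice[f fE] S : exists m, w (C S) = m%:R%:E by apply/config_nat/Gs_fin.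
    exists (pickle (finfun f)) => //; rewrite /B /unp pickleK_inv ifT.
      by move=> S; rewrite ffunE.
    apply/forallP => j; apply/eqP/EFin_nat_inj; rewrite -wk wD natr_sum -sumEFin.
    by apply: eq_bigr => S _; rewrite ffunE fE.
  rewrite /B; case: (unp n) => // f; case: ifP => // /forallP fok wf j.
  rewrite wD -(eqP (fok j)) natr_sum -sumEFin.
  by apply: eq_bigr => S _; exact: wf.
have tA : trivIset setT B.
  move=> n m _ _ [w []]; rewrite /B.
  case En : (unp n) => [f|]; last by [].
  case: (ok f) => // wf; case Em : (unp m) => [f'|]; last by [].
  case: (ok f') => // wf'.
  have ff' : f = f'.
    by apply/ffunP => S; apply: EFin_nat_inj; rewrite -wf -wf'.
  have := @pickle_invK {ffun {set J} -> nat} n; rewrite -/(unp n) En /= => <-.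
  have := @pickle_invK {ffun {set J} -> nat} m; rewrite -/(unp m) Em /= => <-.
  by rewrite ff'.
have mA n : measurable (B n).
  rewrite /B; case: (unp n) => // f; case: ifP => // _.
  exact: measurable_count_event.
rewrite AE !measure_semi_bigcup//; [|exact: bigcupT_measurable..].
apply: eq_eseriesr => n _; rewrite /B; case: (unp n) => [f|]; last by rewrite !measure0.
case: ifP => _; last by rewrite !measure0.
by apply: mu12 => //; exists (fun S : {set J} => jX \in S); rewrite -DE.
Qed.

(* A family of counts is a function of the counts on the cells that it
   generates, whence only disjoint families need to be compared. *)
Lemma fdd_unique A : measurable A -> mu1 A = mu2 A.
Proof.
apply: (measure_unique Pi (count_at X)) => //.
- move=> n; exists unit, (fun=> X), (fun=> n); split=> //.
  by apply/seteqP; split=> [w wn j|w /(_ tt)].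
- apply/seteqP; split=> // w _.
  by have [n wn] := config_nat (Gs_fin w GsX); exists n.
Qed.

End finite_dimensional.

(** * Poisson counts and Mecke's formula *)

Section poisson.
Context (R : realType) (G : transientNetwork R).
Local Notation W := (trajClass G).
Local Notation Omega := (configuration G).
Variable nu : {measure set W -> \bar R}.
Hypothesis nu_fin : forall K : set G, finite_set K -> (nu (hitting_class K) < +oo)%E.
Variable Pr : probability Omega R.
Hypothesis Pr_poisson : poisson_process nu Pr.

Definition bounded_class (D : set W) :=
  measurable D /\ exists2 K : set G, finite_set K & D `<=` hitting_class K.

Lemma bounded_classI A B : bounded_class A -> measurable B -> bounded_class (A `&` B).
Proof.
move=> [mA [K fK AK]] mB; split; first exact: measurableI.
by exists K => // c [/AK].
Qed.

Lemma bounded_class_intensity D : bounded_class D -> (nu D < +oo)%E.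
Proof.
move=> [mD [K fK DK]]; apply: le_lt_trans (nu_fin fK).
by rewrite le_measure ?inE//; exact: measurable_hitting_class.
Qed.

Lemma bounded_class_config D (w : Omega) : bounded_class D -> (w D < +oo)%E.
Proof.
move=> [mD [K fK DK]]; apply: le_lt_trans (config_fin w fK).
have [mu <-] := point_measure_measure w.
by rewrite le_measure ?inE//; exact: measurable_hitting_class.
Qed.

Lemma bounded_class_cover : exists F : nat -> set W,
  (forall i, bounded_class (F i)) /\ \bigcup_i F i = setT.
Proof.
have [g [h gh]] := vertex_code G; exists (fun i => hitting_class [set h i]); split.
  by move=> i; split; [exact: measurable_hitting_class|exists [set h i]].
apply/seteqP; split=> // c _; have [w <-] := to_class_surj c.
by exists (g (w 0)) => //; exists w => //; exists 0; rewrite /= gh.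
Qed.

Definition poisson_weight (l : R) (k : nat) : R := expR (- l) * l ^+ k / k`!%:R.

(** With total mass 1 this recurrence determines the Poisson law. Mecke's formula, the moments and
    the final independence all rest on it. *)
Lemma poisson_weightS l k :
  l * poisson_weight l k = k.+1%:R * poisson_weight l k.+1.
Proof.
rewrite /poisson_weight factS natrM exprS invfM.
have k0 : k.+1%:R != 0 :> R by rewrite pnatr_eq0.
by rewrite [RHS]mulrA mulrACA divff// mul1r mulrA mulrCA.
Qed.

Lemma poisson_counts (I : finType) (C : I -> set W) (k : I -> nat) :
  (forall i, bounded_class (C i)) -> trivIset setT C ->
  Pr (count_event C k) = (\prod_i poisson_weight (fine (nu (C i))) (k i))%:E.
Proof.
move=> bC tC; have [Pr1 _ Pr3] := Pr_poisson.
pose D (i : 'I_#|I|) := C (enum_val i).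
pose B (i : 'I_#|I|) : set (\bar R) := [set (k (enum_val i))%:R%:E].
have -> : count_event C k = \bigcap_i [set w | B i (w (D i))].
  apply/seteqP; split=> [w wk i _|w wk i]; first exact: wk.
  by have := wk (enum_rank i) Logic.I; rewrite /D /B /= enum_rankK.
rewrite Pr3; first last.
- by move=> i j _ _ ij; apply/enum_val_inj; exact: (tC _ _ Logic.I Logic.I ij).
- by move=> i; exact: emeasurable_set1.
- by move=> i; case: (bC (enum_val i)).
rewrite -prodEFin; under eq_bigr => i _.
  rewrite (_ : Pr _ = (poisson_weight (fine (nu (C (enum_val i)))) (k (enum_val i)))%:E).
    over.
  by apply: Pr1; [case: (bC (enum_val i))|exact: (bounded_class_intensity (bC _))].
by rewrite [RHS]big_enum_val.
Qed.

(** The series is E[w(D) ; A] in the form that occurs in [mecke]; when the event fixes the count,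
    one term survives. *)
Lemma series_count_single (D : set W) A n : A `<=` count_at D n ->
  (\sum_(k <oo) k%:R%:E * Pr (A `&` count_at D k) = n%:R%:E * Pr A)%E.
Proof.
move=> An; rewrite (@nneseriesD1 R _ n)//; last first.
  by move=> k _; rewrite mule_ge0 ?lee_fin.
rewrite (setIidl An) eseries0 ?adde0// => k _ kn.
rewrite (_ : _ `&` _ = set0) ?measure0 ?mule0//.
apply/seteqP; split=> // w [/An wn wk]; move/eqP: kn; apply.
exact: (@EFin_nat_inj R _ _ (etrans (esym wk) wn)).
Qed.

Section mecke.
Variable X : set W.
Hypothesis bX : bounded_class X.

Let mX : measurable X. Proof. by case: bX. Qed.
Let nuX : (nu X < +oo)%E. Proof. exact: bounded_class_intensity. Qed.

Let size_biased : {measure set Omega -> \bar R} := mseries (fun k =>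
  mscale (NngNum (ler0n R k)) (mrestr Pr (measurable_count_at k mX))) 0.

Let size_biasedE A :
  size_biased A = (\sum_(k <oo) k%:R%:E * Pr (A `&` count_at X k))%E.
Proof. by []. Qed.

Let size_biased_single A n : measurable A -> A `<=` count_at X n ->
  size_biased A = (n%:R%:E * Pr A)%E.
Proof. by move=> mA An; rewrite size_biasedE; exact: series_count_single. Qed.

Let addX (wc : Omega * W) := add_point wc.2 wc.1.
Let addXE w c D : addX (w, c) D = (\d_c D + w D)%E.
Proof. exact: add_pointE. Qed.

Let prodX : {measure set (Omega * W) -> \bar R} := (Pr \x mfrestr mX nuX)%E.

(** For disjoint cells, these are the configurations whose counts become [k] after a point of [C i]
    is added; there are none if [k i] is 0. *)
Let count_event_add (I : finType) (C : I -> set W) (k : I -> nat) (i : I) : set Omega :=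
  if k i is n.+1 then count_event C (fun l => if l == i then n else k l) else set0.

(** The product measure only charges added points in X, and such a point lies in exactly one of the
    cells that make up X. *)
Let prodX_count_event (I : finType) (C : I -> set W) (k : I -> nat) (J : pred I) :
  (forall i, bounded_class (C i)) -> trivIset setT C ->
  X = \bigcup_(i in [set i | J i]) C i ->
  prodX (addX @^-1` count_event C k) =
  (\sum_(i | J i) Pr (count_event_add C k i) * nu (C i))%E.
Proof.
move=> bC tC XE; have mC i : measurable (C i) by case: (bC i).
have mA : measurable (addX @^-1` count_event C k).
  rewrite -[Y in measurable Y]setTI; apply: measurable_add_point => //.
  exact: measurable_count_event.
have mTX : measurable ([set: Omega] `*` X) by exact: measurableX.
rewrite (measureDI _ mA mTX) (@subset_measure0 _ _ _ _ _ (setT `*` ~` X)) ?add0e//.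
- rewrite (_ : _ `&` _ = \bigcup_(i in [set i | J i]) (count_event_add C k i `*` C i)).
    have mE i : measurable (count_event_add C k i).
      rewrite /count_event_add; case: (k i) => [|n]; first exact: measurable0.
      exact: measurable_count_event.
    rewrite measure_fin_union//.
    - apply: eq_bigr => i Ji; rewrite [LHS]product_measure1E//.
      congr (_ * nu _)%E; apply/setIidl; rewrite XE; exact: bigcup_sup.
    - by move=> i _; exact: measurableX.
    - by move=> i j _ _ [[w c] [[_ /= ci] [_ /= cj]]]; apply: tC => //; exists c.
  apply/seteqP; split=> [[w c] [/= wk [_ /=]]|[w c] [i /= Ji [/=]]].
    rewrite XE => -[i /= Ji ci]; exists i => //; split=> //=.
    have := wk i; rewrite addXE diracE mem_set// /count_event_add.
    have [m wm] := config_nat (bounded_class_config w (bC i)).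
    rewrite wm -EFinD -natrD => /(@EFin_nat_inj R); rewrite add1n => <- l.
    case: eqVneq => [->//|li]; rewrite -wk addXE diracE memNset ?add0e//.
    by move=> cl; move/eqP: li; apply; apply: tC => //; exists c.
  rewrite /count_event_add; case E : (k i) => [//|n] wn ci; split=> [l|].
    rewrite addXE diracE (wn l); case: eqVneq => [->|li].
      by rewrite mem_set// -EFinD E -natrD.
    rewrite memNset ?add0e// => cl; move/eqP: li; apply; apply: tC => //.
    by exists c.
  by split=> //=; rewrite XE; exists i.
- exact: measurableD.
- by apply: measurableX => //; exact: measurableC.
- by move=> [w c] [_ nX]; split=> //= cX; apply: nX.
- rewrite [LHS]product_measure1E//; last exact: measurableC.
  have nX : mfrestr mX nuX (~` X) = 0%E.
    by rewrite /mfrestr /mrestr setICl measure0.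
  by rewrite [Y in (_ * Y)%E]nX mule0.
Qed.

Let poisson_step (I : finType) (C : I -> set W) (k : I -> nat) i :
  (forall i, bounded_class (C i)) -> trivIset setT C ->
  (Pr (count_event_add C k i) * nu (C i) = (k i)%:R%:E * Pr (count_event C k))%E.
Proof.
move=> bC tC; have fC : nu (C i) = (fine (nu (C i)))%:E.
  by rewrite fineK// ge0_fin_numE// bounded_class_intensity.
rewrite /count_event_add fC; case E : (k i) => [|n].
  by rewrite measure0 !mul0e.
rewrite !poisson_counts// (bigD1 i)//= [in RHS](bigD1 i)//= eqxx E -!EFinM.
congr EFin; rewrite mulrA -poisson_weightS [RHS]mulrC mulrCA -mulrA.
rewrite (eq_bigr (fun l => poisson_weight (fine (nu (C l))) (k l))); last first.
  by move=> l /negPf ->.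
by rewrite [LHS]mulrC -mulrA mulrCA.
Qed.

(** On a count event over cells that split X, [poisson_step] turns the term of the cell i into k_i
    times the probability of the event, and the k_i of the cells in X add up to the count of X. *)
Let mecke_prod A : measurable A -> size_biased A = prodX (addX @^-1` A).
Proof.
have [m2 m2E] : exists m2 : {measure set Omega -> \bar R},
    m2 = (fun A => prodX (addX @^-1` A)) :> (_ -> _).
  by exists (measure_function_pushforward__canonical__measure_function_Measure
    prodX (@measurable_add_point R G)).
move=> mA; rewrite -[RHS]/((fun A => prodX (addX @^-1` A)) A) -m2E.
have [F [bF F_cover]] := bounded_class_cover.
apply: (@fdd_unique R G bounded_class X _ _ _ _ F) => //.
- by move=> D [].
- exact: bounded_classI.
- by move=> D w; exact: bounded_class_config.
- move=> n; rewrite (size_biased_single (n := n))//; last exact: measurable_count_at.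
  rewrite -[Y in (_ * Y)%E]fineK ?fin_num_measure//; first by rewrite -EFinM ltry.
  exact: measurable_count_at.
- move=> I C k bC tC [J XE]; have mC i : measurable (C i) by case: (bC i).
  rewrite m2E (prodX_count_event _ bC tC XE).
  rewrite (size_biased_single (n := \sum_(i | J i) k i)); last first.
  + move=> w wk; rewrite /count_at /mkset {1}XE config_fin_union//; last first.
      exact: sub_trivIset tC.
    by rewrite natr_sum -sumEFin; apply: eq_bigr => i _; exact: wk.
  + exact: measurable_count_event.
  under [RHS]eq_bigr => i _ do rewrite (poisson_step _ _ bC tC).
  rewrite natr_sum -sumEFin ge0_sume_distrl//.
Qed.

(* Mecke's formula, in the form
   E[X(D) ; A] = \int_D Pr(w + delta_c \in A) nu(dc). *)
Lemma mecke A : measurable A ->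
  (\sum_(k <oo) k%:R%:E * Pr (A `&` count_at X k) =
   \int[Pr]_w nu ([set c | A (add_point c w)] `&` X))%E.
Proof.
move=> mA; rewrite -size_biasedE mecke_prod//.
rewrite [LHS]/(\int[Pr]_w mfrestr mX nuX (xsection (addX @^-1` A) w))%E.
apply: eq_integral => w _ /=.
by rewrite /mfrestr /mrestr xsectionE.
Qed.

Lemma measurable_mecke (A : set Omega) : measurable A ->
  measurable_fun setT (fun w => nu ([set c | A (add_point c w)] `&` X)).
Proof.
move=> mA; have mAX : measurable (addX @^-1` A).
  by rewrite -[Y in measurable Y]setTI; exact: measurable_add_point.
have := measurable_fun_xsection (mfrestr mX nuX) mAX.
congr measurable_fun; apply/funext => w /=.
by rewrite /mfrestr /mrestr xsectionE.
Qed.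

Lemma measurable_add_section (A : set Omega) (w : Omega) : measurable A ->
  measurable [set c | A (add_point c w)].
Proof.
move=> mA; have mAX : measurable (addX @^-1` A).
  by rewrite -[Y in measurable Y]setTI; exact: measurable_add_point.
by have := measurable_xsection w mAX; rewrite xsectionE.
Qed.

End mecke.

End poisson.

(** * The zero-one law *)

Section poisson_concentration.
Context (R : realType) (G : transientNetwork R).
Local Notation W := (trajClass G).
Local Notation Omega := (configuration G).
Variable nu : {measure set W -> \bar R}.
Hypothesis nu_fin : forall K : set G, finite_set K -> (nu (hitting_class K) < +oo)%E.
Variable Pr : probability Omega R.
Hypothesis Pr_poisson : poisson_process nu Pr.

Lemma poisson_weight_ge0 (l : R) k : 0 <= l -> 0 <= poisson_weight l k.
Proof.
by move=> l0; rewrite /poisson_weight divr_ge0 ?ler0n// mulr_ge0 ?expR_ge0 ?exprn_ge0.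
Qed.

Lemma count_at_weight D k : bounded_class D ->
  Pr (count_at D k) = (poisson_weight (fine (nu D)) k)%:E.
Proof.
move=> bD; have [Pr1 _ _] := Pr_poisson.
by apply: Pr1; [case: bD|exact: (bounded_class_intensity nu_fin bD)].
Qed.

Lemma series_count_at D A : bounded_class D -> measurable A ->
  Pr A = (\sum_(k <oo) Pr (A `&` count_at D k))%E.
Proof.
move=> bD mA; have mD : measurable D by case: bD.
rewrite -measure_semi_bigcup//.
- congr (Pr _); rewrite -setI_bigcupr; apply/esym/setIidl => w _.
  by have [k wk] := config_nat (bounded_class_config w bD); exists k.
- by move=> k; apply: measurableI => //; exact: measurable_count_at.
- move=> i j _ _ [w [[_ wi] [_ wj]]].
  exact: (@EFin_nat_inj R _ _ (etrans (esym wi) wj)).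
- by apply: bigcupT_measurable => k; apply: measurableI => //; exact: measurable_count_at.
Qed.

Section moments.
Variables (l : R) (p : nat -> R).
Hypotheses (l0 : 0 <= l) (p0 : forall k, 0 <= p k).
Hypothesis pS : forall k, l * p k = k.+1%:R * p k.+1.
Hypothesis p1 : (\sum_(k <oo) (p k)%:E = 1)%E.

(** The Stein-Chen identity E[N f(N)] = l E[f(N + 1)]; f = 1 and f(k) = k give the first two
    moments. *)
Lemma poisson_shift (f : nat -> R) : (forall k, 0 <= f k) ->
  (\sum_(k <oo) (k%:R * f k * p k)%:E = l%:E * \sum_(k <oo) (f k.+1 * p k)%:E)%E.
Proof.
move=> f0; have kf0 k : (0 <= (k%:R * f k * p k)%:E :> \bar R)%E.
  by rewrite lee_fin; apply: mulr_ge0 => //; exact: mulr_ge0.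
have fp0 k : (0 <= (f k.+1 * p k)%:E :> \bar R)%E.
  by rewrite lee_fin; exact: mulr_ge0.
rewrite nneseries_recl// !mul0r add0e -nneseriesZl//.
rewrite -nneseries_addn//; apply: eq_eseriesr => k _.
rewrite addn1 -EFinM; congr EFin.
by rewrite [RHS]mulrCA pS [RHS]mulrA; congr (_ * _); exact: mulrC.
Qed.

Lemma poisson_mean : (\sum_(k <oo) (k%:R * p k)%:E = l%:E)%E.
Proof.
transitivity (\sum_(k <oo) (k%:R * 1 * p k)%:E)%E.
  by apply: eq_eseriesr => k _; rewrite mulr1.
rewrite (poisson_shift (f := fun=> 1))//.
under eq_eseriesr => k _ do rewrite mul1r.
by rewrite p1 mule1.
Qed.

Lemma poisson_second_moment :
  (\sum_(k <oo) (k%:R ^+ 2 * p k)%:E = (l ^+ 2 + l)%:E)%E.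
Proof.
rewrite (poisson_shift (f := fun k => k%:R)).
  transitivity (l%:E * (\sum_(k <oo) ((k%:R * p k)%:E + (p k)%:E)))%E.
    by congr (_ * _)%E; apply: eq_eseriesr => k _; rewrite -EFinD -natr1 mulrDl mul1r.
  rewrite nneseriesD//; [|by move=> k _ _; rewrite lee_fin ?mulr_ge0..].
  by rewrite poisson_mean p1 -EFinD -EFinM mulrDr mulr1.
by move=> k.
Qed.

(* Chebyshev's inequality in the form 2 t |k - l| <= (k - l)^2 + t^2. *)
Lemma poisson_deviation (t : R) : 0 < t -> t ^+ 2 <= l ->
  (\sum_(k <oo) (`|k%:R - l| * p k)%:E <= (l / t)%:E)%E.
Proof.
move=> t0 tl; set T := (\sum_(k <oo) _)%E.
have T0 : (0 <= T)%E by apply: nneseries_ge0 => k _ _; rewrite lee_fin mulr_ge0.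
(* The cross term 2 l k of (k - l)^2 stands on the left, so that all series have nonnegative
   terms. *)
have : ((2 * t)%:E * T + (2 * l)%:E * l%:E <=
    (l ^+ 2 + l)%:E + (l ^+ 2 + t ^+ 2)%:E)%E.
  rewrite -[in X in (_ <= _ + X)%E](mule1 (l ^+ 2 + t ^+ 2)%:E) -p1.
  rewrite -[X in (_ + _ * X <= _)%E]poisson_mean -poisson_second_moment.
  rewrite -!nneseriesZl; [|by move=> k _; rewrite lee_fin ?mulr_ge0..].
  rewrite -!nneseriesD; [|by move=> k _ _;
    rewrite lee_fin ?mulr_ge0 ?addr_ge0 ?sqr_ge0// ?ltW ?mulr_gt0..].
  apply: lee_nneseries => [k _ _|k _].
    by rewrite adde_ge0// lee_fin ?mulr_ge0// ltW.
  rewrite -!EFinM -!EFinD lee_fin.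
  rewrite !mulrA -!mulrDl ler_wpM2r//.
  have := sqr_ge0 (`|k%:R - l| - t).
  rewrite sqrrB real_normK ?num_real// sqrrB.
  by move: (k%:R : R) (`|k%:R - l|) => a b; lra.
(* Cancelling 2 l^2 leaves 2 t T <= l + t^2 <= 2 l. *)
case: T T0 => [T| |] //= T0.
  rewrite -!EFinM -!EFinD !lee_fin ler_pdivlMr// => H.
  by nra.
by rewrite gt0_muley ?lte_fin ?mulr_gt0.
Qed.

End moments.

(** The joint weights of S and the count are dominated by the Poisson weights, so the error is at
    most E|w(D) - nu(D)|, whatever the event S. *)
Lemma count_deviation D S (t : R) : bounded_class D -> measurable S ->
  0 < t -> t ^+ 2 <= fine (nu D) ->
  exists2 u : R, (\sum_(k <oo) k%:R%:E * Pr (S `&` count_at D k) = u%:E)%E &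
    `|u - fine (nu D) * fine (Pr S)| <= fine (nu D) / t.
Proof.
move=> bD mS t0 tl; have mD : measurable D by case: bD.
set l := fine (nu D) in tl *.
have l0 : 0 <= l by rewrite fine_ge0.
have p1 : (\sum_(k <oo) (poisson_weight l k)%:E = 1)%E.
  rewrite -(probability_setT Pr) (series_count_at bD measurableT).
  by apply: eq_eseriesr => k _; rewrite setTI count_at_weight.
have mSk k : measurable (S `&` count_at D k).
  by apply: measurableI => //; exact: measurable_count_at.
pose a k := fine (Pr (S `&` count_at D k)).
have aE k : Pr (S `&` count_at D k) = (a k)%:E by rewrite fineK// fin_num_measure.
have a0 k : 0 <= a k by rewrite fine_ge0.
have ap k : a k <= poisson_weight l k.
  rewrite -lee_fin -aE -count_at_weight// le_measure ?inE//.
  exact: measurable_count_at.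
have PS : Pr S = (\sum_(k <oo) (a k)%:E)%E.
  by rewrite (series_count_at bD mS); apply: eq_eseriesr => k _; exact: aE.
have PSE : Pr S = (fine (Pr S))%:E by rewrite fineK// fin_num_measure.
have dev := poisson_deviation l0 (fun k => poisson_weight_ge0 k l0)
  (poisson_weightS l) p1 t0 tl.
set T := (\sum_(k <oo) _)%E in dev.
have la0 k : (0 <= l%:E * (a k)%:E :> \bar R)%E by rewrite -EFinM lee_fin mulr_ge0.
have ka0 k : (0 <= (k%:R * a k)%:E :> \bar R)%E by rewrite lee_fin mulr_ge0.
have d0 k : (0 <= (`|k%:R - l| * poisson_weight l k)%:E :> \bar R)%E.
  by rewrite lee_fin; apply: mulr_ge0 => //; exact: poisson_weight_ge0.
have ld k (r : R) : r <= `|k%:R - l| -> r * a k <= `|k%:R - l| * poisson_weight l k.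
  by move=> rk; rewrite (le_trans (ler_wpM2r (a0 k) rk))// ler_wpM2l.
have U_le : (\sum_(k <oo) (k%:R * a k)%:E <= l%:E * Pr S + T)%E.
  rewrite PS -nneseriesZl; last by move=> k _; rewrite lee_fin.
  rewrite -nneseriesD//.
  apply: lee_nneseries => [//|k _].
  by rewrite -EFinM -EFinD lee_fin -lerBlDl -mulrBl; apply: ld; exact: ler_norm.
have U_ge : (l%:E * Pr S <= \sum_(k <oo) (k%:R * a k)%:E + T)%E.
  rewrite PS -nneseriesZl; last by move=> k _; rewrite lee_fin.
  rewrite -nneseriesD//.
  apply: lee_nneseries => [//|k _].
  rewrite -EFinM -EFinD lee_fin -lerBlDl -mulrBl; apply: ld.
  by rewrite distrC ler_norm.
have UE : (\sum_(k <oo) k%:R%:E * Pr (S `&` count_at D k) =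
    \sum_(k <oo) (k%:R * a k)%:E)%E.
  by apply: eq_eseriesr => k _; rewrite aE EFinM.
rewrite UE; set U := (\sum_(k <oo) _)%E in U_le U_ge *.
have U0 : (0 <= U)%E by apply: nneseries_ge0 => k _ _; rewrite lee_fin mulr_ge0.
have Ule : (U <= (l * fine (Pr S) + l / t)%:E)%E.
  by rewrite (le_trans U_le)// PSE EFinD EFinM leeD2l.
have Uge : ((l * fine (Pr S))%:E <= U + (l / t)%:E)%E.
  by rewrite EFinM -PSE (le_trans U_ge)// leeD2l.
have UE' : U = (fine U)%:E.
  by rewrite fineK// ge0_fin_numE// (le_lt_trans Ule)// ltry.
exists (fine U) => //; rewrite UE' -EFinD !lee_fin in Ule Uge.
by rewrite ler_distl; apply/andP; split; lra.
Qed.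

End poisson_concentration.

(** * Independence of a non-local event from all counts *)

Section nonlocal_zero_one.
Context (R : realType) (G : transientNetwork R).
Local Notation W := (trajClass G).
Local Notation Omega := (configuration G).
Variable P : G -> probability (halfTraj G) R.
Hypothesis P_markov : forall x : G, markov_law (@half_traj R G) x (P x).
Variable nu : {measure set W -> \bar R}.
Hypothesis nu_intensity : interlacement_intensity P nu.
Variable Pr : probability Omega R.
Hypothesis Pr_poisson : poisson_process nu Pr.
Variable o : G.
Hypothesis nu_arrow : forall A B : set (halfTraj G),
  invariant_events A -> invariant_events B ->
  nu (arrow A B) = 0%E \/ nu (arrow A B) = +oo%E.
Variable E : set Omega.
Hypothesis nE : nonlocal_events E.

Let nu_fin := intensity_hitting_fin nu_intensity.
Let mE : measurable E. Proof. exact: nonlocal_measurable. Qed.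

Let atom := atomic (@invariant_events R G) (P o).

Lemma bounded_class0 : bounded_class (set0 : set W).
Proof. by split=> //; exists set0. Qed.

Lemma bounded_classU (D1 D2 : set W) :
  bounded_class D1 -> bounded_class D2 -> bounded_class (D1 `|` D2).
Proof.
move=> [m1 [K fK DK]] [m2 [K' fK' DK']]; split; first exact: measurableU.
exists (K `|` K'); first by rewrite finite_setU.
by move=> c [/DK|/DK'] [w [m Km] <-]; exists w => //; exists m; [left|right].
Qed.

Lemma large_bounded_class (Y : set W) (r : R) : measurable Y -> nu Y = +oo%E ->
  exists D, [/\ bounded_class D, D `<=` Y & (r%:E <= nu D)%E].
Proof.
move=> mY Yoo; have [F [bF F_cover]] := bounded_class_cover G.
pose H n := Y `&` \big[setU/set0]_(i < n) F i.
have bH n : bounded_class (H n).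
  rewrite /H setIC; apply: bounded_classI => //.
  by apply: big_ind => //; [exact: bounded_class0|exact: bounded_classU].
have YE : \bigcup_n H n = Y.
  rewrite /H -setI_bigcupr; apply/setIidl => c _.
  have : (\bigcup_i F i) c by rewrite F_cover.
  move=> [i _ Fi]; exists i.+1 => //.
  by rewrite -bigcup_mkord; exists i => /=.
have cvgH : (nu \o H @ \oo --> nu (\bigcup_n H n))%classic.
  apply: nondecreasing_cvg_mu.
  - by move=> n; case: (bH n).
  - by rewrite YE.
  - move=> m n mn; apply/subsetPset; apply: setIS; rewrite -!bigcup_mkord.
    by move=> c [i /= im Fi]; exists i => //=; exact: leq_trans mn.
rewrite YE Yoo in cvgH; move/cvgeyPge : cvgH => /(_ r)[n _ /(_ n (leqnn n)) rn].
by exists (H n); split=> //; exact: subIsetl.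
Qed.

Section recurrence.
Variables (A B : set (halfTraj G)) (D Z : set W) (L : set Omega) (k : nat).
Hypotheses (atA : atom A) (atB : atom B).
Hypotheses (bD : bounded_class D) (DAB : D `<=` arrow A B).
Hypotheses (mZ : measurable Z) (Zoo : (nu Z < +oo)%E) (DZ : D `&` Z = set0).
Hypothesis mL : measurable L.
Hypothesis LZ : forall c w, ~ Z c -> L (add_point c w) <-> L w.

Let mD : measurable D. Proof. by case: bD. Qed.
(** In the application [L] prescribes the counts of the cells already treated and [Z] is their
    union. Adding a trajectory outside [Z] does not affect [L]. *)
Let M := count_at D k `&` L.
Let A1 := E `&` count_at D k.+1 `&` L.

Let mM : measurable M.
Proof. by apply: measurableI => //; exact: measurable_count_at. Qed.

Let mA1 : measurable A1.
Proof.
by apply: measurableI => //; apply: measurableI => //; exact: measurable_count_at.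
Qed.

Let sec w := [set c | E (add_point c w)].

Let secD w : nu ([set c | A1 (add_point c w)] `&` D) =
  (if w \in M then nu (D `&` sec w) else 0)%E.
Proof.
rewrite (_ : _ `&` _ = if w \in M then D `&` sec w else set0).
  by case: ifP => // _; rewrite measure0.
have countD c : D c -> count_at D k.+1 (add_point c w) <-> count_at D k w.
  move=> Dc; rewrite /count_at /mkset add_pointE diracE mem_set//.
  have [m ->] := config_nat (bounded_class_config w bD).
  rewrite -EFinD -natrD add1n.
  by split=> /(@EFin_nat_inj R) => [[->]|->].
have nZ c : D c -> ~ Z c by move=> Dc Zc; have : (D `&` Z) c by []; rewrite DZ.
apply/seteqP; split=> [c [[[Ec nc] Lc] Dc]|c].
  rewrite ifT//; apply/mem_set; split; first exact/(countD c).
  exact/(LZ w (nZ c Dc)).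
case: ifPn => // /set_mem [nw Lw] [Dc Ec]; split=> //; split.
  by split=> //; exact/(countD c).
exact/(LZ w (nZ c Dc)).
Qed.

Let secD0 D0 w : bounded_class D0 -> D0 `&` (D `|` Z) = set0 ->
  nu ([set c | (E `&` M) (add_point c w)] `&` D0) =
  (if w \in M then nu (D0 `&` sec w) else 0)%E.
Proof.
move=> bD0 D0DZ.
rewrite (_ : _ `&` _ = if w \in M then D0 `&` sec w else set0).
  by case: ifP => // _; rewrite measure0.
have nDZ c : D0 c -> ~ (D `|` Z) c.
  by move=> D0c DZc; have : (D0 `&` (D `|` Z)) c by []; rewrite D0DZ.
have Mc c : D0 c -> M (add_point c w) <-> M w.
  move=> D0c; have nc := nDZ c D0c.
  have [nDc nZc] : ~ D c /\ ~ Z c by split=> ?; apply: nc; [left|right].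
  have nE' : count_at D k (add_point c w) <-> count_at D k w.
    by rewrite /count_at /mkset add_pointE diracE memNset// add0e.
  by split=> -[/nE' ? /(LZ w nZc) ?]; split.
apply/seteqP; split=> [c [[Ec Mcw] D0c]|c].
  by rewrite ifT//; apply/mem_set/(Mc c).
by case: ifPn => // /set_mem Mw [D0c Ec]; split=> //; split=> //; exact/(Mc c).
Qed.

(** Mecke's formula turns both sides into integrals over the same event [M]: a point of D raises its
    count from k to k + 1, a point of D0 leaves [M] unchanged. The integrands agree by
    [arrow_proportional]. *)
Let swap D0 : bounded_class D0 -> D0 `<=` arrow A B -> D0 `&` (D `|` Z) = set0 ->
  (nu D0 * (k.+1%:R%:E * Pr A1) =
   nu D * \sum_(j <oo) j%:R%:E * Pr (E `&` M `&` count_at D0 j))%E.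
Proof.
move=> bD0 D0AB D0DZ; have mD0 : measurable D0 by case: bD0.
have mEM : measurable (E `&` M) by exact: measurableI.
rewrite -(@series_count_single _ _ Pr D); last by move=> w [[]].
rewrite (mecke nu_fin Pr_poisson bD mA1) (mecke nu_fin Pr_poisson bD0 mEM).
rewrite -!ge0_integralZl//.
- apply: eq_integral => w _; rewrite secD secD0//; case: ifP => _; last by rewrite !mule0.
  apply: (arrow_proportional P_markov nu_intensity atA atB) => //.
    exact: measurable_add_section.
  exact: nonlocal_out_invariant.
- exact: (measurable_mecke nu_fin bD0 mEM).
- exact: (measurable_mecke nu_fin bD mA1).
Qed.

(* Adding one trajectory of D to a configuration has the same effect on E as
   adding one trajectory of a large D0 \subset (A -> B); the number of
   trajectories in D0 is close to its mean nu(D0), whence adding one does not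
   affect the conditional probability of E. *)
Lemma nonlocal_recurrence :
  k.+1%:R * fine (Pr (E `&` count_at D k.+1 `&` L)) =
  fine (nu D) * fine (Pr (E `&` (count_at D k `&` L))).
Proof.
rewrite -/M -/A1; have mEM : measurable (E `&` M) by exact: measurableI.
have iA : invariant_events A by case: atA.
have iB : invariant_events B by case: atB.
have mAB : measurable (arrow A B) by exact: measurable_arrow.
have fD : nu D = (fine (nu D))%:E.
  by rewrite fineK// ge0_fin_numE// (bounded_class_intensity nu_fin bD).
have PA1 : Pr A1 = (fine (Pr A1))%:E by rewrite fineK// fin_num_measure.
have [AB0|ABoo] := nu_arrow iA iB.
  have D0 : nu D = 0%E by exact: subset_measure0 AB0.
  rewrite D0 /= mul0r; apply/EFin_inj; rewrite EFinM -PA1.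
  rewrite -(@series_count_single _ _ Pr D); last by move=> w [[]].
  rewrite (mecke nu_fin Pr_poisson bD mA1) integral0_eq// => w _.
  apply: subset_measure0 D0; last exact: subIsetr.
  - by apply: measurableI => //; exact: measurable_add_section.
  - by [].
(* D and Z have finite intensity, so removing them leaves infinite intensity from which to choose
   D0. *)
pose Y := arrow A B `\` (D `|` Z).
have mDZ : measurable (D `|` Z) by exact: measurableU.
have Yoo : nu Y = +oo%E.
  apply/eqP; rewrite -leye_eq leNgt; apply/negP => Yoo.
  have : (nu (arrow A B) <= nu Y + nu (D `|` Z))%E.
    rewrite (measureDI _ mAB mDZ) leeD2l// le_measure ?inE//; exact: measurableI.
  rewrite ABoo leye_eq => /eqP YDZ.
  have : (nu Y + nu (D `|` Z) < +oo)%E.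
    rewrite lte_add_pinfty// (le_lt_trans (measureU2 _ mD mZ))//.
    by apply: lte_add_pinfty => //; exact: (bounded_class_intensity nu_fin bD).
  by rewrite YDZ ltxx.
set q1 := fine (Pr A1); set q := fine (Pr (E `&` M)); set l := fine (nu D).
have l0 : 0 <= l by rewrite fine_ge0.
(* With m = nu(D0) >= (n + 1)^2 the deviation bound applies for t = n + 1; its error m / (n + 1) is
   multiplied by l / m. *)
have close (n : nat) : `|k.+1%:R * q1 - l * q| <= l / n.+1%:R.
  have [D0 [bD0 D0Y rD0]] := large_bounded_class (n.+1%:R ^+ 2) (measurableD mAB mDZ) Yoo.
  have D0DZ : D0 `&` (D `|` Z) = set0.
    by apply/seteqP; split=> // c [/D0Y[_ nDZ] DZc]; exact: nDZ.
  have D0AB : D0 `<=` arrow A B by move=> c /D0Y[].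
  have fD0 : nu D0 = (fine (nu D0))%:E.
    by rewrite fineK// ge0_fin_numE// (bounded_class_intensity nu_fin bD0).
  set m := fine (nu D0) in fD0.
  have nm : n.+1%:R ^+ 2 <= m by rewrite -lee_fin -fD0.
  have n0 : 0 < n.+1%:R :> R by rewrite ltr0n.
  have m0 : 0 < m by rewrite (lt_le_trans _ nm)// exprn_gt0.
  have [u uE ud] := count_deviation nu_fin Pr_poisson bD0 mEM n0 nm.
  have := swap bD0 D0AB D0DZ; rewrite uE fD0 fD PA1 -!EFinM => -[].
  rewrite -/q1 -/l -/m -/q in ud * => E1.
  have E2 : k.+1%:R * q1 - l * q = l / m * (u - m * q).
    have : m != 0 by rewrite gt_eqF.
    move=> mn0; apply: (mulfI mn0); rewrite mulrBr E1.
    by field.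
  rewrite E2 normrM ger0_norm ?divr_ge0 ?(ltW m0)//.
  rewrite (le_trans (ler_wpM2l _ ud)) ?divr_ge0 ?(ltW m0)//.
  by rewrite mulrA divfK ?gt_eqF.
apply/eqP; rewrite -subr_eq0 -normr_le0; apply/ler_addgt0Pl => e e0.
have [n ne] : exists n : nat, l / n.+1%:R <= e.
  exists (Num.truncn (l / e)); rewrite ler_pdivrMr ?ltr0n// mulrC -ler_pdivrMr//.
  by rewrite ltW// truncnS_gt.
by rewrite addr0 (le_trans (close n)).
Qed.

End recurrence.

Let typed D := bounded_class D /\ exists A B, [/\ atom A, atom B & D `<=` arrow A B].

(** Cells are treated one at a time. With the other counts fixed, the recurrence makes the
    probabilities proportional to Poisson weights, and summing over the count identifies the factor
    as Pr(E, [L s]). *)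
Lemma nonlocal_independence (I : finType) (C : I -> set W) (k : I -> nat) :
  (forall i, typed (C i)) -> trivIset setT C ->
  fine (Pr (E `&` count_event C k)) =
  fine (Pr E) * \prod_i poisson_weight (fine (nu (C i))) (k i).
Proof.
move=> tyC tC; have bC i : bounded_class (C i) by case: (tyC i).
have mC i : measurable (C i) by case: (bC i).
pose L (s : seq I) : set Omega := \bigcap_(i in [set` s]) count_at (C i) (k i).
have mL s : measurable (L s).
  apply: fin_bigcap_measurable => [|i _]; [exact: finite_seq|exact: measurable_count_at].
suff H s : uniq s -> fine (Pr (E `&` L s)) =
    fine (Pr E) * \prod_(i <- s) poisson_weight (fine (nu (C i))) (k i).
  rewrite -big_enum -H ?enum_uniq//; congr (fine (Pr (_ `&` _))).
  by apply/seteqP; split=> [w wk i _|w wk i]; [exact: wk|apply: wk; rewrite /= mem_enum].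
elim: s => [_|i s ih /= /andP[nis us]].
  by rewrite big_nil mulr1 /L set_nil bigcap_set0 setIT.
rewrite big_cons mulrCA -ih//.
set l := fine (nu (C i)); set pw := poisson_weight l.
pose q n := fine (Pr (E `&` (count_at (C i) n `&` L s))).
have mq n : measurable (E `&` (count_at (C i) n `&` L s)).
  by apply: measurableI => //; apply: measurableI => //; exact: measurable_count_at.
have qE n : Pr (E `&` (count_at (C i) n `&` L s)) = (q n)%:E.
  by rewrite fineK// fin_num_measure.
pose Z := \bigcup_(j in [set` s]) C j.
have bZ : bounded_class Z.
  rewrite /Z bigcup_seq.
  by apply: big_ind => //; [exact: bounded_class0|exact: bounded_classU].
have LZ c w : ~ Z c -> L s (add_point c w) <-> L s w.
  move=> nZ; have E' j : j \in s ->
      count_at (C j) (k j) (add_point c w) <-> count_at (C j) (k j) w.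
    move=> js; rewrite /count_at /mkset add_pointE diracE memNset ?add0e//.
    by move=> Cjc; apply: nZ; exists j.
  by split=> Lw j /= js; apply/E' => //; exact: Lw.
have CZ : C i `&` Z = set0.
  apply/seteqP; split=> // c [Cic [j /= js Cjc]].
  have ij : i = j by apply: tC => //; exists c.
  by move/negP: nis; rewrite ij.
have [_ [A [B [atA atB CAB]]]] := tyC i.
have step n : n.+1%:R * q n.+1 = l * q n.
  rewrite /q setIA.
  apply: (@nonlocal_recurrence A B (C i) Z (L s) n) => //; first by case: bZ.
  exact: (bounded_class_intensity nu_fin bZ).
have pw0 : pw 0%N != 0.
  by rewrite /pw /poisson_weight expr0 mulr1 fact0 divr1 gt_eqF ?expR_gt0.
pose r := q 0%N / pw 0%N.
have qr n : q n = r * pw n.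
  elim: n => [|n ihn]; first by rewrite /r divfK.
  have n0 : n.+1%:R != 0 :> R by rewrite pnatr_eq0.
  by apply: (mulfI n0); rewrite step ihn mulrCA poisson_weightS mulrCA.
have r0 : 0 <= r by rewrite divr_ge0 ?fine_ge0// poisson_weight_ge0// fine_ge0.
have rE : fine (Pr (E `&` L s)) = r.
  have mEL : measurable (E `&` L s) by exact: measurableI.
  rewrite (series_count_at Pr (bC i) mEL).
  transitivity (fine (r%:E * \sum_(n <oo) Pr (setT `&` count_at (C i) n))%E).
    congr fine; rewrite -nneseriesZl//; apply: eq_eseriesr => n _.
    rewrite -setIA [L s `&` _]setIC qE qr setTI.
    by rewrite (count_at_weight nu_fin Pr_poisson)// -EFinM.
  by rewrite -(series_count_at Pr (bC i) measurableT) probability_setT mule1.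
rewrite rE -[RHS]mulrC -qr; congr (fine (Pr (_ `&` _))).
apply/seteqP; split=> [w Lw|w [wi Lw] j /=].
  split; first by apply: Lw; rewrite /= mem_head.
  by move=> j /= js; apply: Lw; rewrite /= in_cons js orbT.
by rewrite in_cons => /predU1P[->//|]; exact: Lw.
Qed.

Hypothesis atoms : purely_atomic (@invariant_events R G) (P o).

(** The atoms partition W^+ with no exceptional set, so both ends of every trajectory lie in atoms.
    A bounded cover cuts the countably many arrows into admissible pieces. *)
Lemma typed_cover : exists F : nat -> set W,
  (forall i, typed (F i)) /\ \bigcup_i F i = setT.
Proof.
have [F [bF F_cover]] := bounded_class_cover G.
have [Q [/countable_injP[f fi] Qat _ QT]] := atoms.
have [A0 QA0] : exists A, Q A.
  by have [A QA _] : (\bigcup_(A in Q) A) point by [rewrite QT]; exists A.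
pose e n := xget A0 [set A | Q A /\ f A = n].
have eQ n : Q (e n) by rewrite /e; case: xgetP => // A _ [].
have ef A : Q A -> e (f A) = A.
  move=> QA; have [Qe fe] := xgetPex A0
    (ex_intro (fun A' => Q A' /\ f A' = f A) A (conj QA erefl)).
  by apply: fi; rewrite ?inE.
pose F' n := if unpickle n is Some (m, a, b) then F m `&` arrow (e a) (e b) else set0.
exists F'; split.
  move=> n; rewrite /F'; case: unpickle => [[[m a] b]|].
    have /Qat[ia _ _] := eQ a; have /Qat[ib _ _] := eQ b.
    split; first by apply: bounded_classI => //; exact: measurable_arrow.
    by exists (e a), (e b); split; [exact: Qat|exact: Qat|exact: subIsetr].
  split; first exact: bounded_class0.
  by exists A0, A0; split; [exact: Qat|exact: Qat|].
apply/seteqP; split=> // c _; have [w wc] := to_class_surj c.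
have [m _ Fm] : (\bigcup_i F i) c by rewrite F_cover.
have [A QA Aw] : (\bigcup_(A in Q) A) (traj_before w 0) by rewrite QT.
have [B QB Bw] : (\bigcup_(A in Q) A) (traj_after w 0) by rewrite QT.
exists (pickle (m, f A, f B)) => //; rewrite /F' pickleK !ef//.
by split=> //; exists w.
Qed.

Lemma nonlocal_zero_one : Pr E = 0%E \/ Pr E = 1%E.
Proof.
have [F [tF F_cover]] := typed_cover.
have PE : Pr E = (fine (Pr E))%:E by rewrite fineK// fin_num_measure.
pose mu1 : {measure set Omega -> \bar R} := mrestr Pr mE.
pose mu2 : {measure set Omega -> \bar R} :=
  mscale (NngNum (fine_ge0 (measure_ge0 Pr E))) Pr.
have mu2E S : mu2 S = (Pr E * Pr S)%E by rewrite PE.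
have t0 : typed set0.
  split; first exact: bounded_class0.
  by have [_ [A [B [atA atB _]]]] := tF 0%N; exists A, B; split.
have /(_ E mE) : forall S, measurable S -> mu1 S = mu2 S.
  (* Both measures are finite, so the reference set can be empty: its count is always 0. *)
  apply: (@fdd_unique R G typed set0 _ _ _ t0 F tF F_cover).
  - by move=> D [[]].
  - move=> D D' [bD [A [B [atA atB DAB]]]] mD'; split; first exact: bounded_classI.
    by exists A, B; split=> // c [/DAB].
  - by move=> D w [bD _]; exact: bounded_class_config.
  - move=> n; rewrite (le_lt_trans (probability_le1 _ _)) ?ltry//.
    by apply: measurableI => //; exact: measurable_count_at.
  - move=> I C k tyC tC _.
    have mC i : measurable (C i) by case: (tyC i) => -[].
    have mCk := measurable_count_event k mC.
    rewrite mu2E (poisson_counts nu_fin Pr_poisson)//; last by move=> i; case: (tyC i).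
    rewrite PE -EFinM -nonlocal_independence// fineK ?fin_num_measure//.
      by rewrite setIC.
    exact: measurableI.
rewrite mu2E /mu1 /= /mrestr setIid PE -EFinM => -[].
set a := fine _ => aa; have /eqP : a * (1 - a) = 0 by rewrite mulrBr mulr1 -aa subrr.
by rewrite mulf_eq0 subr_eq0 => /orP[/eqP->|/eqP<-]; [left|right].
Qed.

End nonlocal_zero_one.

Theorem theorem6 (R : realType) (G : transientNetwork R)
    (P : G -> probability (halfTraj G) R)
    (P_markov : forall x : G, markov_law (@half_traj R G) x (P x))
    (nu : {measure set (trajClass G) -> \bar R})
    (nu_intensity : interlacement_intensity P nu)
    (Pr : probability (configuration G) R)
    (Pr_poisson : poisson_process nu Pr) :
  (exists x : G, purely_atomic (@invariant_events R G) (P x)) ->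
  (forall A B : set (halfTraj G), invariant_events A -> invariant_events B ->
     nu (arrow A B) = 0%E \/ nu (arrow A B) = +oo%E) ->
  forall E : set (configuration G), nonlocal_events E ->
    Pr E = 0%E \/ Pr E = 1%E.
Proof.
move=> [x atoms] nu_arrow E nE.
exact: (nonlocal_zero_one P_markov nu_intensity Pr_poisson nu_arrow nE atoms).
Qed.
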